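(* Let $\|\cdot\|$ be a norm on $\mathbb{R}^n$, let $\Omega\subseteq\mathbb{R}^n$ be an open set and $F:\Omega\to\mathbb{R}^n$ an analytic function. Take $x_*\in\Omega$ such that $F'(x_* )$ is invertible and $F(x_* )=0$, and let $$\kappa:=\sup\{t>0: B(x_*,t)\subset\Omega\},\qquad \gamma:=\sup_{m>1}\left\|\frac{F'(x_* )^{-1}F^{(m)}(x_* )}{m!}\right\|^{1/(m-1)}<+\infty,$$ where $\gamma>0$. Take $0\le\vartheta<1$ and $0\le\omega_2<\omega_1$ such that $\omega_1\vartheta+\omega_2<1$. Let $a=\omega_1(1+\vartheta)$, $b=1-\omega_1\vartheta-\omega_2$ and $$\sigma:=\min\left\{\kappa,\ \frac{a+4b-\sqrt{(a+4b)^2-8b^2}}{4b\gamma}\right\}.$$ Then any inexact Newton-like method for solving $F(x)=0$ with initial point $x_0\in B(x_*,\sigma)\setminus\{x_*\}$, $$x_{k+1}=x_k+S_k,\qquad B(x_k)S_k=-F(x_k)+r_k,\qquad k=0,1,\ldots,$$ where $B(x_k)$ is an invertible approximation of $F'(x_k)$ satisfying $$\|B(x_k)^{-1}F'(x_k)\|\le\omega_1,\qquad\|B(x_k)^{-1}F'(x_k)-I\|\le\omega_2,$$ and the residual $r_k$ satisfies $\|P_kr_k\|\le\theta_k\|P_kF(x_k)\|$ for some sequence $\{\theta_k\}$ of non-negative numbers and some sequence $\{P_k\}$ of invertible matrices satisfying $\theta_k\,\mathrm{cond}(P_kF'(x_k))\le\vartheta$, is well defined, its sequence $\{x_k\}$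 is contained in $B(x_*,\sigma)$, converges to $x_*$, and $$\|x_{k+1}-x_*\|\le\left[\omega_1(1+\vartheta)\frac{\gamma\|x_0-x_*\|}{2(1-\gamma\|x_0-x_*\|)^2-1}+\omega_1\vartheta+\omega_2\right]\|x_k-x_*\|,\qquad\forall\,k=0,1,\ldots.$$
   Context: $B(a,\delta)=\{x\in\mathbb{R}^n:\|x-a\|<\delta\}$ ($\kappa=+\infty$ is allowed). $F^{(m)}(x_* )$ is the $m$-th derivative, an $m$-linear map. Norms of linear and multilinear operators on $\mathbb{R}^n$ are the operator norms induced by $\|\cdot\|$; $I$ is the identity; for an invertible operator $T$, $\mathrm{cond}(T):=\|T\|\,\|T^{-1}\|$. ''Well defined'' means that each iterate $x_k$ lies in $\Omega$ and $F'(x_k)$ is invertible, so that the conditions defining the next step make sense. *)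

(* Defs.v *)
From HB Require Import structures.
From mathcomp Require Import all_boot all_order all_algebra.
From mathcomp Require Import all_classical all_reals all_analysis.

Set Implicit Arguments.
Unset Strict Implicit.
Unset Printing Implicit Defensive.

Import Order.TTheory GRing.Theory Num.Theory.
Import numFieldNormedType.Exports.

Local Open Scope classical_set_scope.
Local Open Scope ring_scope.

(* Vectors of R^n are column vectors, so that a matrix A acts by A *m v.
   The library topology on 'cV[R]_n is that of the max norm `|v|; since all
   norms on R^n are equivalent, openness, limits and Frechet derivatives do not
   depend on the norm. Quantities that do depend on it take N as a parameter. *)

Definition is_norm (R : realType) (n : nat) (N : 'cV[R]_n -> R) : Prop :=
  [/\ forall u v, N (u + v) <= N u + N v,
      forall (c : R) v, N (c *: v) = `|c| * N v
    & forall v, N v = 0 -> v = 0].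

Definition nball (R : realType) (n : nat) (N : 'cV[R]_n -> R)
    (a : 'cV[R]_n) (delta : \bar R) : set 'cV[R]_n :=
  [set x | ((N (x - a))%:E < delta)%E].

Definition opnorm (R : realType) (n : nat) (N : 'cV[R]_n -> R)
    (A : 'M[R]_n) : R :=
  sup [set N (A *m v) | v in [set v | N v <= 1]].

Definition cond (R : realType) (n : nat) (N : 'cV[R]_n -> R)
    (A : 'M[R]_n) : R :=
  opnorm N A * opnorm N (invmx A).

Definition multilinear (R : realType) (n m : nat)
    (T : ('I_m -> 'cV[R]_n) -> 'cV[R]_n) : Prop :=
  forall (i : 'I_m) (v : 'I_m -> 'cV[R]_n),
    linear (fun u : 'cV[R]_n => T (dfwith v i u)).

Definition mopnorm (R : realType) (n m : nat) (N : 'cV[R]_n -> R)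
    (T : ('I_m -> 'cV[R]_n) -> 'cV[R]_n) : R :=
  sup [set N (T v) | v in [set v | forall i, N (v i) <= 1]].

(* A function on an open set is encoded by a total function F; the local
   notions below, taken at a point of that set, only see the values of F
   there. *)

(* F is the sum, near x, of a power series sum_m T_m(h, ..., h) whose
   coefficients T_m are m-linear maps with ||T_m|| rho^m bounded. *)
Definition analytic_at (R : realType) (n : nat)
    (F : 'cV[R]_n -> 'cV[R]_n) (x : 'cV[R]_n) : Prop :=
  exists (T : forall m, ('I_m -> 'cV[R]_n) -> 'cV[R]_n) (rho C : R),
    [/\ 0 < rho,
        forall m, multilinear (@T m),
        forall m (v : 'I_m -> 'cV[R]_n),
          `|T m v| * rho ^+ m <= C * \prod_(i < m) `|v i|
      & forall h : 'cV[R]_n, `|h| < rho ->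
          series (fun m => T m (fun=> h)) @ \oo --> F (x + h)].

Definition jac (R : realType) (n : nat)
    (F : 'cV[R]_n -> 'cV[R]_n) (x : 'cV[R]_n) : 'M[R]_n :=
  \matrix_(i, j) ('d F x (delta_mx j 0 : 'cV[R]_n)) i 0.

Lemma mul_jac (R : realType) (n : nat) (F : 'cV[R]_n -> 'cV[R]_n)
    (x v : 'cV[R]_n) : jac F x *m v = 'd F x v.
Proof.
have {2}-> : v = \sum_j v j 0 *: (delta_mx j 0 : 'cV[R]_n).
  by rewrite [LHS]matrix_sum_delta; apply: eq_bigr => j _; rewrite big_ord1.
rewrite linear_sum; apply/matrixP => i k; rewrite (ord1 k) mxE summxE.
by apply: eq_bigr => j _; rewrite linearZ !mxE mulrC.
Qed.

(* The m-th Frechet derivative as an m-linear map. F^(m+1)(x) is the derivative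
   at x of y |-> F^(m)(y); in finite dimension this derivative can be computed
   after evaluating F^(m)(y) at fixed arguments. *)
Fixpoint nderiv (R : realType) (n : nat) (F : 'cV[R]_n -> 'cV[R]_n) (m : nat) :
    'cV[R]_n -> ('I_m -> 'cV[R]_n) -> 'cV[R]_n :=
  match m with
  | 0 => fun x _ => F x
  | m'.+1 => fun x v =>
      'd (fun y : 'cV[R]_n => @nderiv R n F m' y (fun i => v (lift ord0 i))) x
        (v ord0)
  end.

Definition inscribed_radius (R : realType) (n : nat) (N : 'cV[R]_n -> R)
    (Omega : set 'cV[R]_n) (x : 'cV[R]_n) : \bar R :=
  ereal_sup [set t%:E | t in [set t : R | 0 < t /\ nball N x t%:E `<=` Omega]].

Definition smale_gamma (R : realType) (n : nat) (N : 'cV[R]_n -> R)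
    (F : 'cV[R]_n -> 'cV[R]_n) (x : 'cV[R]_n) : \bar R :=
  ereal_sup
    [set (mopnorm N (fun v : 'I_m -> 'cV[R]_n =>
            (m`!%:R)^-1 *: (invmx (jac F x) *m nderiv F x v))
          `^ ((m.-1)%:R^-1))%:E
    | m in [set m : nat | (1 < m)%N]].

Definition inexact_newton_like_step (R : realType) (n : nat)
    (N : 'cV[R]_n -> R) (F : 'cV[R]_n -> 'cV[R]_n) (omega1 omega2 vtheta : R)
    (B : 'cV[R]_n -> 'M[R]_n) (P : nat -> 'M[R]_n) (theta : nat -> R)
    (r S x : nat -> 'cV[R]_n) (k : nat) : Prop :=
  [/\ x k.+1 = x k + S k /\ B (x k) *m S k = - F (x k) + r k,
      [/\ B (x k) \in unitmx,
          opnorm N (invmx (B (x k)) *m jac F (x k)) <= omega1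
        & opnorm N (invmx (B (x k)) *m jac F (x k) - 1%:M) <= omega2],
      P k \in unitmx /\ 0 <= theta k,
      N (P k *m r k) <= theta k * N (P k *m F (x k))
    & theta k * cond N (P k *m jac F (x k)) <= vtheta].

(* Main.v *)
Require Import Defs.
From HB Require Import structures.
From mathcomp Require Import all_boot all_order all_algebra.
From mathcomp Require Import all_classical all_reals all_analysis.
From mathcomp Require Import ring lra.

Import Order.TTheory GRing.Theory Num.Theory.
Import numFieldNormedType.Exports.

Local Open Scope classical_set_scope.
Local Open Scope ring_scope.

(** Everything is read off the segment s |-> xs + s h, h = x - xs, in the norm
  N' v = N (F'(xs)^-1 v). The definition of gamma says that at s = 0 the
  derivatives of s |-> F'(xs + s h) v are dominated by those of
  N v / (1 - u s)^2, u = gamma N h. Near each point of the segment, analyticity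
  gives Cauchy estimates C m! / rho^m, so Taylor's formula with remainder lets
  the domination spread across a neighbourhood of each point, hence along the
  whole segment; no identity theorem or global power series is needed. Integrating,
  N' (F'(x) v - F'(xs) v) <= ((1 - u)^-2 - 1) N v and
  N' (F'(x) h - F(x)) <= u (1 - u)^-2 N h, so F'(x) is invertible and the exact
  Newton step from x has error at most u / (2 (1 - u)^2 - 1) N h. The inexact
  step perturbs this bound linearly, and it contracts below the smaller root of
  2 b u^2 - (a + 4 b) u + b. *)

(** * Multilinear maps *)

Section Multilinear.
Context {R : realType} {n m : nat}.
Variable T : ('I_m -> 'cV[R]_n) -> 'cV[R]_n.
Hypothesis linT : multilinear T.
Implicit Types u v w : 'I_m -> 'cV[R]_n.

Lemma multilinearB i v x y :
  T (dfwith v i x) - T (dfwith v i y) = T (dfwith v i (x - y)).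
Proof.
by have := linT i v (-1) y x; rewrite !scaleN1r [- y + x]addrC => ->; rewrite addrC.
Qed.

Lemma multilinear0 i v : v i = 0 -> T v = 0.
Proof.
move=> vi0; have <- : dfwith v i 0 = v.
  apply/funext => j; have [<-|ij] := eqVneq i j; first by rewrite dfwithin vi0.
  by rewrite dfwithout.
by rewrite -{1}(subrr 0) -multilinearB subrr.
Qed.

Definition splice u w k : 'I_m -> 'cV[R]_n :=
  fun j => if (j < k)%N then w j else u j.

(** Arguments are exchanged one slot at a time along [splice], and consecutive values of [T] differ
    in a single slot, where linearity applies. *)
Lemma multilinear_telescope u w :
  T u - T w = \sum_(i < m) T (dfwith (splice u w i) i (u i - w i)).
Proof.
have -> : T u = T (splice u w 0) by [].
have -> : T w = T (splice u w m).
  by congr T; apply/funext => j; rewrite /splice ltn_ord.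
rewrite -opprB -(telescope_sumr (fun k => T (splice u w k))) // big_mkord -sumrN; apply: eq_bigr => i _.
rewrite -multilinearB opprB; congr (_ - _); congr T; apply/funext => j.
  have [<-|ij] := eqVneq i j; first by rewrite dfwithin /splice ltnn.
  by rewrite dfwithout.
have [<-|ij] := eqVneq i j; first by rewrite dfwithin /splice ltnSn.
rewrite dfwithout // /splice ltnS leq_eqVlt.
by have -> : (j == i :> nat) = false by apply/negbTE; rewrite eq_sym.
Qed.

Context {c : R}.
Hypothesis boundT : forall v, `|T v| <= c * \prod_i `|v i|.

Hypothesis c_ge0 : 0 <= c.

(** Two distinct slots carry vectors of size d, the others of size r. The factor [r ^+ 2] stays on
    the left because r may be 0. *)
Lemma prod_norm_le2 v r i j (d : R) : 0 <= r -> i != j ->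
  (forall l, `|v l| <= r) -> `|v i| <= d -> `|v j| <= d ->
  (\prod_l `|v l|) * r ^+ 2 <= d ^+ 2 * r ^+ m.
Proof.
move=> r0 ij vr vid vjd; rewrite (bigD1 i) //= (bigD1 j) 1?eq_sym //=.
have -> : r ^+ m = r * (r * \prod_(l | (l != i) && (l != j)) r).
  have <- : \prod_(l | l != i) r = r * \prod_(l | (l != i) && (l != j)) r.
    by rewrite (bigD1 j) 1?eq_sym.
  by rewrite -[r * _](bigD1 i (P := predT)) //= prodr_const card_ord.
set p := \prod_(l | _) `|v l|; set q := \prod_(l | _) r.
have p0 : 0 <= p by rewrite prodr_ge0.
have pq : p <= q by apply: ler_prod => l _; rewrite normr_ge0 vr.
have -> : `|v i| * (`|v j| * p) * r ^+ 2 = (`|v i| * `|v j|) * (r ^+ 2 * p).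
  by ring.
have -> : d ^+ 2 * (r * (r * q)) = (d * d) * (r ^+ 2 * q) by ring.
apply: ler_pM; rewrite ?mulr_ge0 ?exprn_ge0 //; first exact: ler_pM.
by rewrite ler_wpM2l // exprn_ge0.
Qed.

(** Telescoping twice leaves m^2 terms, each with k (or 0) in two distinct slots, so each is
    quadratic in k. *)
Lemma multilinear_diff_le h k (r : R) : `|h| + `|k| <= r ->
  `|T (fun=> h + k) - T (fun=> h) - \sum_(i < m) T (dfwith (fun=> h) i k)|
     * r ^+ 2 <= c * m%:R ^+ 2 * r ^+ m * `|k| ^+ 2.
Proof.
move=> hkr; have r0 : 0 <= r by apply: le_trans hkr; rewrite addr_ge0.
have hr : `|h| <= r by apply: le_trans hkr; rewrite lerDl.
have kr : `|k| <= r by apply: le_trans hkr; rewrite lerDr.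
have hkr' : `|h + k| <= r := le_trans (ler_normD _ _) hkr.
rewrite multilinear_telescope -sumrB.
have -> : c * m%:R ^+ 2 * r ^+ m * `|k| ^+ 2 =
    \sum_(i < m) \sum_(j < m) c * (`|k| ^+ 2 * r ^+ m).
  by rewrite !sumr_const !card_ord -mulrnA -[RHS]mulr_natl natrM; ring.
apply: le_trans (ler_wpM2r _ (ler_norm_sum _ _ _)) _; first by rewrite exprn_ge0.
rewrite mulr_suml; apply: ler_sum => i _.
have -> : h + k - h = k by rewrite addrC addKr.
rewrite multilinear_telescope.
apply: le_trans (ler_wpM2r _ (ler_norm_sum _ _ _)) _; first by rewrite exprn_ge0.
rewrite mulr_suml; apply: ler_sum => j _.
set v := dfwith _ _ _.
have nonneg : 0 <= c * (`|k| ^+ 2 * r ^+ m).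
  by rewrite !mulr_ge0 ?exprn_ge0.
(* On the diagonal both argument families hold k in slot i, so their difference there is 0. *)
have [ij|ij] := eqVneq i j.
  rewrite (@multilinear0 j) ?normr0 ?mul0r //.
  by rewrite /v ij !dfwithin subrr.
apply: le_trans (ler_wpM2r _ (boundT v)) _; first by rewrite exprn_ge0.
rewrite -mulrA ler_wpM2l //; apply: (@prod_norm_le2 _ _ i j) => //.
- move=> l; rewrite /v; have [<-|jl] := eqVneq j l.
    rewrite dfwithin !dfwithout // /splice; case: ifP => _; rewrite ?subrr ?normr0 //.
    by rewrite addrC addKr.
  rewrite dfwithout // /splice; case: ifP => _.
    have [<-|il] := eqVneq i l; first by rewrite dfwithin.
    by rewrite dfwithout.
  have [<-|il] := eqVneq i l; first by rewrite dfwithin.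
  by rewrite dfwithout //; case: ifP.
- rewrite /v dfwithout 1?eq_sym // /splice !dfwithin.
  by case: ifP.
- rewrite /v dfwithin !dfwithout // /splice; case: ifP => _.
    by rewrite subrr normr0.
  by rewrite addrC addKr.
Qed.

End Multilinear.

Section Insert.
Context {R : realType} {n m : nat}.

Definition insert_arg (v : 'cV[R]_n) (i : 'I_m.+1) (w : 'I_m -> 'cV[R]_n) :
  'I_m.+1 -> 'cV[R]_n := fun j => oapp w v (unlift i j).

Variable T : ('I_m.+1 -> 'cV[R]_n) -> 'cV[R]_n.
Hypothesis linT : multilinear T.

Lemma insert_arg_const v i (h : 'cV[R]_n) :
  insert_arg v i (fun=> h) = dfwith (fun=> h) i v.
Proof.
apply/funext => j; rewrite /insert_arg; case: unliftP => [l|] -> /=.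
  by rewrite dfwithout // neq_lift.
by rewrite dfwithin.
Qed.

Lemma insert_arg_dfwith v i w l (u : 'cV[R]_n) :
  insert_arg v i (dfwith w l u) = dfwith (insert_arg v i w) (lift i l) u.
Proof.
apply/funext => j; rewrite /insert_arg; case: unliftP => [k|] -> /=.
  have [<-|lk] := eqVneq l k; first by rewrite !dfwithin.
  by rewrite !dfwithout ?(inj_eq (@lift_inj _ _)) // liftK.
by rewrite dfwithout 1?eq_sym ?neq_lift // unlift_none.
Qed.

(** On the diagonal w = (h, ..., h) this is the derivative of h |-> T(h, ..., h) in the direction v.
    [T] is not assumed symmetric, hence the sum over all slots. *)
Definition contract (v : 'cV[R]_n) (w : 'I_m -> 'cV[R]_n) : 'cV[R]_n :=
  \sum_(i < m.+1) T (insert_arg v i w).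

Lemma multilinear_contract v : multilinear (contract v).
Proof.
move=> l w a x y; rewrite /contract scaler_sumr -big_split /=.
by apply: eq_bigr => i _; rewrite !insert_arg_dfwith; exact: linT.
Qed.

Lemma linear_contract w : linear (contract ^~ w).
Proof.
move=> a u v; rewrite /contract scaler_sumr -big_split /=.
apply: eq_bigr => i _.
have insE v' : insert_arg v' i w = dfwith (insert_arg 0 i w) i v'.
  apply/funext => j; rewrite /insert_arg; case: unliftP => [l|] -> /=.
    by rewrite dfwithout ?neq_lift // liftK.
  by rewrite dfwithin.
by rewrite !(insE (_ + _)) !(insE u) !(insE v); exact: linT.
Qed.

Lemma contract_bound (c : R) v : (forall u, `|T u| <= c * \prod_i `|u i|) ->
  forall w, `|contract v w| <= (m.+1%:R * c * `|v|) * \prod_i `|w i|.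
Proof.
move=> Tc w; apply: le_trans (ler_norm_sum _ _ _) _.
have -> : (m.+1%:R * c * `|v|) * \prod_i `|w i| =
  \sum_(i < m.+1) c * (`|v| * \prod_j `|w j|).
  by rewrite sumr_const card_ord -mulr_natl; ring.
apply: ler_sum => i _; apply: le_trans (Tc _) _.
rewrite (bigD1_ord i) //= /insert_arg unlift_none /=.
by under [X in _ * (_ * X) <= _]eq_bigr do rewrite liftK /=.
Qed.

End Insert.

(** * Differentiability and power series *)

Lemma diff_of_quadratic_error (R : realType) (V W : normedModType R) (G L : V -> W)
    (y : V) (A Q d : R) : linear L -> (forall k, `|L k| <= A * `|k|) ->
    0 < d -> 0 <= Q ->
    (forall k, `|k| < d -> `|G (y + k) - G y - L k| <= Q * `|k| ^+ 2) ->
  differentiable G y /\ 'd G y = L :> (V -> W).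
Proof.
move=> linL LA d0 Q0 GL.
pose f : {linear V -> W} := HB.pack L (GRing.isLinear.Build _ _ _ _ L linL).
have fc : continuous f.
  apply: bounded_linear_continuous; apply/linear_boundedP.
  near=> r => k; apply: le_trans (LA k) _.
  by apply: ler_wpM2r => //; near: r; exact: nbhs_pinfty_ge.
have fo : G \o shift y = cst (G y) + f +o_ 0 id.
  apply/eqaddoP => e e0; near=> k.
  have -> : (G \o shift y - (cst (G y) + f)) k = G (y + k) - G y - L k.
    by rewrite !fctE /= [k + y]addrC opprD addrA.
  apply: le_trans (GL _ _) _.
    by near: k; exact: nbhs0_lt.
  rewrite expr2 mulrA ler_wpM2r //.
  (* [Q + 1] rather than [Q], which may be 0. *)
  have : `|k| < e / (Q + 1).
    by near: k; apply: nbhs0_lt; rewrite divr_gt0 // ltr_wpDl.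
  rewrite ltr_pdivlMr ?ltr_wpDl // => /ltW; apply: le_trans.
  by rewrite mulrC ler_wpM2l // lerDl.
have dE := diff_unique fc fo; split; last exact: dE.
apply/diff_locallyP; split; first by rewrite dE.
by rewrite dE.
Unshelve. all: by end_near. Qed.

Lemma diff_eps_delta (R : realType) (V W : normedModType R) (G : V -> W) (y : V)
    (e : R) : differentiable G y -> 0 < e ->
  exists2 d : R, 0 < d &
    forall k, `|k| < d -> `|G (y + k) - G y - 'd G y k| <= e * `|k|.
Proof.
move=> /diff_locally /eqaddoP /(_ e) dG e0.
have /nbhs_normP[d /= d0 dd] := dG e0; exists d => // k kd.
have := dd k; rewrite /ball_ /= sub0r normrN => /(_ kd).
by rewrite !fctE /= [k + y]addrC opprD addrA.
Qed.

Section Series.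
Context {R : realType} {n : nat}.
Implicit Types (u : ('cV[R]_n) ^nat) (K : R).

Lemma sum_half_le K M : 0 <= K -> \sum_(0 <= m < M) K * (2^-1 : R) ^+ m <= 2 * K.
Proof.
move=> K0; rewrite -mulr_sumr mulrC ler_wpM2r //.
have -> : \sum_(0 <= m < M) (2^-1 : R) ^+ m = 2 - 2 * 2^-1 ^+ M.
  elim: M => [|M IH]; first by rewrite big_nil expr0; lra.
  by rewrite big_nat_recr //= IH exprS; lra.
by rewrite lerBlDr lerDl mulr_ge0 // exprn_ge0 // invr_ge0.
Qed.

Lemma cvg_series_half u K : (forall m, `|u m| <= K * 2^-1 ^+ m) -> cvgn (series u).
Proof.
move=> uK; have : cvgn [normed series u].
  apply: (@series_le_cvg _ _ (geometric K 2^-1)) => //.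
  - by move=> m; exact: normr_ge0.
  - by move=> m; exact: le_trans (normr_ge0 _) (uK m).
  - by apply: is_cvg_geometric_series; rewrite ger0_norm ?invr_ge0 //; lra.
move=> /cauchy_cvgP/cauchy_seriesP u_ncvg.
apply/cauchy_cvgP/cauchy_seriesP => e /u_ncvg.
apply: filterS => m /=; rewrite ger0_norm ?sumr_ge0 //.
by apply: le_lt_trans; apply: ler_norm_sum.
Qed.

Lemma norm_series_le_half u K (l : 'cV[R]_n) : series u @ \oo --> l ->
  (forall m, `|u m| <= K * 2^-1 ^+ m) -> `|l| <= 2 * K.
Proof.
move=> ul uK; have K0 : 0 <= K.
  by have := uK 0; rewrite expr0 mulr1; exact: le_trans (normr_ge0 _).
apply: (@ler_cvg_to _ \oo _ _ (fun m => `|series u m|) (cst (2 * K))).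
- exact: cvg_norm.
- exact: cvg_cst.
- near=> M; apply: le_trans (ler_norm_sum _ _ _) _.
  apply: (@le_trans _ _ (\sum_(0 <= m < M) K * 2^-1 ^+ m)); first exact: ler_sum.
  exact: sum_half_le.
Unshelve. all: by end_near. Qed.

End Series.

(** The bounds form an arbitrary sequence c because differentiation turns c into (m+1) c_(m+1) |v|
    on the same ball; exact constants thus survive any number of derivatives. *)
Definition has_power_series {R : realType} {n : nat} (G : 'cV[R]_n -> 'cV[R]_n)
    (x : 'cV[R]_n) (r : R) (c : nat -> R) : Prop :=
  exists T : forall m, ('I_m -> 'cV[R]_n) -> 'cV[R]_n,
    [/\ forall m, multilinear (@T m),
        forall m (v : 'I_m -> 'cV[R]_n), `|T m v| <= c m * \prod_(i < m) `|v i|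
      & forall h : 'cV[R]_n, `|h| < r ->
          series (fun m => T m (fun=> h)) @ \oo --> G (x + h)].

Section PowerSeries.
Context {R : realType} {n : nat}.
Variables (G : 'cV[R]_n -> 'cV[R]_n) (x : 'cV[R]_n) (r K q : R) (c : nat -> R).
Hypotheses (r_gt0 : 0 < r) (q_ge0 : 0 <= q) (qr : 8 * (q * r) <= 1).
Hypotheses (c_ge0 : forall m, 0 <= c m) (c_le : forall m, c m <= K * q ^+ m).

Let K_ge0 : 0 <= K.
Proof. by have := le_trans (c_ge0 0) (c_le 0); rewrite expr0 mulr1. Qed.

(** The spare factor 4 absorbs the polynomial factors m+1 and m^2 created by differentiation, and a
    geometric series of ratio 1/2 remains. *)
Let qr_half m : (4 * (q * r)) ^+ m <= 2^-1 ^+ m.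
Proof.
apply: lerXn2r; rewrite ?nnegrE ?mulr_ge0 ?invr_ge0 ?(ltW r_gt0) //.
by move: qr; set t := q * r => ?; lra.
Qed.

Lemma has_power_series_bound y : has_power_series G x r c -> `|y - x| < r ->
  `|G y| <= 2 * K.
Proof.
move=> [T [_ Tc TG]] yx; have := TG _ yx; rewrite [x + _]addrC subrK.
move=> /norm_series_le_half; apply => m; apply: le_trans (Tc _ _) _.
rewrite prodr_const card_ord.
apply: (@le_trans _ _ (K * (q * r) ^+ m)).
  rewrite exprMn mulrA; apply: ler_pM; rewrite ?exprn_ge0 //.
  by apply: lerXn2r; rewrite ?nnegrE ?(ltW r_gt0) // ltW.
rewrite ler_wpM2l //; apply: le_trans (qr_half m).
apply: lerXn2r; rewrite ?nnegrE ?mulr_ge0 ?(ltW r_gt0) //.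
by have := mulr_ge0 q_ge0 (ltW r_gt0); set t := q * r => ?; lra.
Qed.

(** Termwise differentiation: the quadratic remainders of the homogeneous terms sum to O(|k|^2), so
    the series of contracted coefficients is the differential. *)
Lemma has_power_series_diff : has_power_series G x r c ->
  (forall y, `|y - x| < r -> differentiable G y) /\
  (forall v, has_power_series (fun y => 'd G y v) x r
               (fun m => m.+1%:R * c m.+1 * `|v|)).
Proof.
move=> [T [linT Tc TG]].
pose D v h m := contract (T m.+1) v (fun=> h).
have D_le v h m : `|h| < r -> `|D v h m| <= (2 * K * q * `|v|) * 2^-1 ^+ m.
  move=> hr; apply: le_trans (contract_bound _ _ v (Tc m.+1) _) _.
  rewrite prodr_const card_ord.
  have -> : 2 * K * q * `|v| * 2^-1 ^+ m = `|v| * (2 * K * q * 2^-1 ^+ m) by ring.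
  rewrite [_ * `|v|]mulrC -[leLHS]mulrA ler_wpM2l //.
  apply: (@le_trans _ _ (2 ^+ m.+1 * (K * q ^+ m.+1) * r ^+ m)).
    apply: ler_pM; rewrite ?mulr_ge0 ?exprn_ge0 //.
      by apply: ler_pM => //; rewrite -natrX ler_nat ltnW // ltn_expl.
    by apply: lerXn2r; rewrite ?nnegrE ?(ltW r_gt0) // ltW.
  have -> : 2 ^+ m.+1 * (K * q ^+ m.+1) * r ^+ m = 2 * K * q * (2 * (q * r)) ^+ m.
    by rewrite !exprS !exprMn; ring.
  rewrite ler_wpM2l ?mulr_ge0 //; apply: le_trans (qr_half m).
  apply: lerXn2r; rewrite ?nnegrE ?mulr_ge0 ?(ltW r_gt0) //.
  by have := mulr_ge0 q_ge0 (ltW r_gt0); set t := q * r => ?; lra.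
pose L h v := limn (series (D v h)).
have DL h v : `|h| < r -> series (D v h) @ \oo --> L h v.
  by move=> hr; apply: (@cvg_series_half _ _ _ (2 * K * q * `|v|)) => m; exact: D_le.
have linL h : `|h| < r -> linear (L h).
  move=> hr a u v; apply: cvg_lim => //.
  have -> : series (D (a *: u + v) h) = a *: series (D u h) + series (D v h).
    apply/funext => M; rewrite !fctE /series /= scaler_sumr -big_split /=.
    by apply: eq_bigr => m _; rewrite /D (linear_contract _ (linT _)).
  by apply: cvgD; [apply: cvgZr|]; exact: DL.
have dG h : `|h| < r ->
    differentiable G (x + h) /\ 'd G (x + h) = L h :> ('cV[R]_n -> 'cV[R]_n).
  (* Each constant carries a factor 2, the sum of the geometric series; the radius r - |h| keeps h +
     k in the ball of convergence. *)
  move=> hr; apply: (@diff_of_quadratic_error _ _ _ _ _ _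
    (2 * (2 * K * q)) (2 * (K * r ^- 2)) (r - `|h|)).
  - exact: linL.
  - move=> v; have := norm_series_le_half _ _ _ (DL h v hr) (fun m => D_le v h m hr).
    by rewrite !mulrA.
  - by rewrite subr_gt0.
  - by rewrite !mulr_ge0 // invr_ge0 exprn_ge0 // ltW.
  move=> k kr; have hkr : `|h| + `|k| < r by rewrite addrC -ltrBrDr.
  have hk : `|h + k| < r := le_lt_trans (ler_normD _ _) hkr.
  pose S m := \sum_(i < m) T m (dfwith (fun=> h) i k).
  pose u m := T m (fun=> h + k) - T m (fun=> h) - S m.
  have SL : series S @ \oo --> L h k.
    (* The degree 0 term has no slot, so [S 0] = 0 and the two series agree after a shift by one. *)
    have := DL h k hr; have <- : [sequence series S M.+1]_M = series (D k h).
      apply/funext => M; rewrite /series /= big_nat_recl // {1}/S big_ord0 add0r.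
      apply: eq_bigr => m _; rewrite /S /D /contract; apply: eq_bigr => i _.
      by rewrite insert_arg_const.
    by rewrite cvg_shiftS.
  have uL : series u @ \oo --> G (x + h + k) - G (x + h) - L h k.
    have -> : series u = series (fun m => T m (fun=> h + k)) -
        series (fun m => T m (fun=> h)) - series S.
      by apply/funext => M; rewrite !fctE /series /= -!sumrB.
    by apply: cvgB => //; apply: cvgB; [rewrite -addrA|]; exact: TG.
  have -> : 2 * (K * r ^- 2) * `|k| ^+ 2 = 2 * (K * r ^- 2 * `|k| ^+ 2) by ring.
  apply: (norm_series_le_half _ _ _ uL) => m.
  have -> : K * r ^- 2 * `|k| ^+ 2 * 2^-1 ^+ m =
      K * 2^-1 ^+ m * `|k| ^+ 2 / r ^+ 2 by ring.
  rewrite ler_pdivlMr ?exprn_gt0 //.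
  apply: le_trans (multilinear_diff_le _ (linT m) (Tc m) (c_ge0 m) _ _ _ (ltW hkr)) _.
  rewrite ler_wpM2r ?exprn_ge0 //.
  apply: (@le_trans _ _ (K * q ^+ m * 4 ^+ m * r ^+ m)).
    (* Here m^2 <= 4^m. *)
    rewrite ler_wpM2r ?exprn_ge0 ?(ltW r_gt0) //.
    apply: ler_pM; rewrite ?exprn_ge0 //.
    rewrite -!natrX ler_nat -[4%N]/(2 ^ 2)%N -expnM mulnC expnM.
    by rewrite leq_exp2r // ltnW // ltn_expl.
  by rewrite -2!mulrA -!exprMn [4 * r]mulrC mulrA [_ * 4]mulrC ler_wpM2l.
split.
  move=> y yx; have [] := dG _ yx.
  by rewrite addrC subrK.
move=> v; exists (fun m => contract (@T m.+1) v); split.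
- by move=> m; exact: multilinear_contract.
- by move=> m; exact: contract_bound.
- by move=> h hr; have [_ ->] := dG _ hr; exact: DL.
Qed.

End PowerSeries.

(** * Cauchy estimates for iterated derivatives *)

Lemma bin_le_exp2 n j : ('C(n, j) <= 2 ^ n)%N.
Proof.
elim: n j => [|n IH] [|j] //; first by rewrite bin0 expn_gt0.
by rewrite binS expnS mul2n -addnn leq_add.
Qed.

(** The falling factorial is a binomial coefficient times j!. Bounding the binomial by a power of 2
    makes the growth geometric, at the price of a halved radius. *)
Lemma ffact_le_exp2 m j : ((m + j) ^_ j <= 2 ^ (m + j) * j`!)%N.
Proof. by rewrite -bin_ffact leq_mul2r bin_le_exp2 orbT. Qed.

Section Nderiv.
Context {R : realType} {n : nat}.
Variable F : 'cV[R]_n -> 'cV[R]_n.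

(* Cauchy estimates: differentiating j times turns coefficients bounded by
   C / rho^m into coefficients bounded by C (m+j)!/m! / rho^(m+j). *)
Lemma analytic_nderiv x : analytic_at F x ->
  exists r rho C : R, [/\ 0 < r, 0 < rho, 0 <= C,
    forall j (v : 'I_j -> 'cV[R]_n) y, `|y - x| < r ->
      differentiable (fun z => nderiv F z v) y
  & forall j (v : 'I_j -> 'cV[R]_n) y, `|y - x| < r ->
      `|nderiv F y v| <= C * j`!%:R * rho ^- j * \prod_i `|v i|].
Proof.
move=> [T [rho [C [rho0 linT TC TF]]]].
have C0 : 0 <= C.
  have := TC 0 (fun=> 0); rewrite expr0 mulr1 big_ord0 mulr1.
  exact: le_trans (normr_ge0 _).
(* Chosen so that 8 q r = 1 with q = 2 / rho. *)
pose r := rho / 16; have r0 : 0 < r by rewrite divr_gt0.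
have rrho : r < rho by rewrite /r ltr_pdivrMr // ltr_pMr //; lra.
(* [c j v] bounds the coefficients of the j-th derivative and is stable under the recursion of
   [has_power_series_diff]; [K j v] is the constant of its geometric majorant of ratio 2 / rho. *)
pose c j (v : 'I_j -> 'cV[R]_n) m : R :=
  C * ((m + j) ^_ j)%:R * rho ^- (m + j) * \prod_i `|v i|.
pose K j (v : 'I_j -> 'cV[R]_n) : R :=
  C * j`!%:R * (2 / rho) ^+ j * \prod_i `|v i|.
have q0 : 0 <= 2 / rho by rewrite divr_ge0 // ltW.
have qr : 8 * (2 / rho * r) <= 1.
  have -> : 8 * (2 / rho * r) = 1 by rewrite /r; field; rewrite gt_eqF.
  by [].
have c0 j v m : 0 <= c j v m.
  by rewrite !mulr_ge0 ?invr_ge0 ?exprn_ge0 ?prodr_ge0 // ltW.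
have cK j v m : c j v m <= K j v * (2 / rho) ^+ m.
  have -> : K j v * (2 / rho) ^+ m =
      C * (2 ^+ (m + j) * j`!%:R) * rho ^- (m + j) * \prod_i `|v i|.
    by rewrite /K !exprMn !exprVn !exprD invfM; ring.
  rewrite ler_wpM2r ?prodr_ge0 // ler_wpM2r ?invr_ge0 ?exprn_ge0 ?(ltW rho0) //.
  by rewrite ler_wpM2l // -natrX -natrM ler_nat ffact_le_exp2.
have ps j v : has_power_series (fun z => @nderiv R n F j z v) x r (c j v).
  elim: j v => [|j IH] v.
    exists T; split=> [||h hr]; first exact: linT.
      move=> m w.
      rewrite /c addn0 ffactn0 big_ord0 mulr1n !mulr1 mulrAC ler_pdivlMr ?exprn_gt0 //.
    by apply: TF; exact: lt_trans rrho.
  have [_ /(_ (v ord0))] := has_power_series_diff _ _ _ _ _ _ r0 q0 qr (c0 _ _)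
    (cK _ _) (IH (fun i => v (lift ord0 i))).
  congr has_power_series; apply/funext => m.
  rewrite /c big_ord_recl addnS ffactnSr subSn ?leq_addl // addnK natrM -addSn.
  by ring.
(* The ratio 2 / rho halves the radius, and summing the series doubles the constant. *)
exists r, (rho / 2), (2 * C); split=> //.
- by rewrite divr_gt0.
- by rewrite mulr_ge0.
- move=> j v.
  by have [] := has_power_series_diff _ _ _ _ _ _ r0 q0 qr (c0 _ _) (cK _ _) (ps j v).
- move=> j v y yx.
  have := has_power_series_bound _ _ _ _ _ _ r0 q0 qr (c0 _ _) (cK _ _) _ (ps j v) yx.
  by rewrite /K -exprVn invf_div !mulrA.
Qed.

(** Homogeneity lets the arguments be normalised under [mopnorm]. The induction differentiates the
    identity, so it must hold near x, which openness of [Omega] provides. *)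
Lemma nderiv_scale (Omega : set 'cV[R]_n) : open Omega ->
    (forall x, Omega x -> analytic_at F x) ->
  forall j (c : 'I_j -> R) (v : 'I_j -> 'cV[R]_n) x, Omega x ->
    nderiv F x (fun i => c i *: v i) = (\prod_i c i) *: nderiv F x v.
Proof.
move=> Oo Fan; elim=> [|j IH] c v x Ox; first by rewrite big_ord0 scale1r.
have dF w : differentiable (fun z => @nderiv R n F j z w) x.
  have [r [rho [C [r0 _ _ dF _]]]] := analytic_nderiv x (Fan x Ox).
  by apply: dF; rewrite subrr normr0.
transitivity ('D_(c ord0 *: v ord0) (fun z => @nderiv R n F j z
    (fun i => c (lift ord0 i) *: v (lift ord0 i))) x).
  by rewrite deriveE.
rewrite (@near_eq_derive _ _ _ _
  ((\prod_(i < j) c (lift ord0 i)) \*: (fun z => @nderiv R n F j z (fun i => v (lift ord0 i))))).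
  rewrite deriveZ; last exact: diff_derivable.
  by rewrite deriveE // linearZ scalerA big_ord_recl mulrC.
have := open_nbhs_nbhs (conj Oo Ox); apply: filterS => z Oz /=.
exact: IH.
Qed.

End Nderiv.

(** * Norms and mean value inequalities *)

Lemma mx_entry_le_norm (R : realType) m n (v : 'M[R]_(m, n)) i j : `|v i j| <= `|v|.
Proof.
rewrite [leRHS]/Num.norm /= mx_normrE; apply/bigmax_geP; right.
by exists (i, j).
Qed.

Section Norm.
Context {R : realType} {n : nat} {N : 'cV[R]_n -> R} (hN : is_norm N).
Implicit Types u v w : 'cV[R]_n.

Lemma is_normD u v : N (u + v) <= N u + N v. Proof. by have [] := hN. Qed.

Lemma is_normZ c v : N (c *: v) = `|c| * N v. Proof. by have [] := hN. Qed.

Lemma is_norm0 : N 0 = 0. Proof. by rewrite -(scale0r 0) is_normZ normr0 mul0r. Qed.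

Lemma is_norm_eq0 v : N v = 0 -> v = 0. Proof. by have [_ _] := hN; exact. Qed.

Lemma is_normN v : N (- v) = N v.
Proof. by rewrite -scaleN1r is_normZ normrN1 mul1r. Qed.

Lemma is_norm_ge0 v : 0 <= N v.
Proof. by have := is_normD v (- v); rewrite subrr is_norm0 is_normN; lra. Qed.

Lemma is_normB u v : N (u - v) <= N u + N v.
Proof. by rewrite -[N v]is_normN is_normD. Qed.

Lemma is_norm_distC u v : N (u - v) = N (v - u).
Proof. by rewrite -opprB is_normN. Qed.

Lemma is_norm_le_add u v : N u <= N v + N (u - v).
Proof. by rewrite -{1}(subrK v u) addrC is_normD. Qed.

Lemma is_norm_sum I (s : seq I) (f : I -> 'cV[R]_n) :
  N (\sum_(i <- s) f i) <= \sum_(i <- s) N (f i).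
Proof.
elim: s => [|i s IH]; first by rewrite !big_nil is_norm0.
by rewrite !big_cons; apply: le_trans (is_normD _ _) _; rewrite lerD2l.
Qed.

Lemma is_norm_le_mx : exists2 c, 0 < c & forall v, N v <= c * `|v|.
Proof.
exists (1 + \sum_(i < n) N (delta_mx i 0)).
  by rewrite ltr_pwDl // sumr_ge0 // => i _; exact: is_norm_ge0.
move=> v; have {1}-> : v = \sum_j v j 0 *: (delta_mx j 0 : 'cV[R]_n).
  by rewrite [LHS]matrix_sum_delta; apply: eq_bigr => j _; rewrite big_ord1.
apply: le_trans (is_norm_sum _ _ _) _.
rewrite mulrDl mul1r mulr_suml; apply: ler_wpDl => //; apply: ler_sum => i _.
rewrite is_normZ mulrC ler_wpM2l ?is_norm_ge0 //.
exact: mx_entry_le_norm.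
Qed.

End Norm.

Section MeanValue.
Context {R : realType}.

(* Cousin's lemma: reduces the mean value inequality and the propagation of
   majorants along a segment to local statements. *)
Lemma interval_cousin (a b : R) (Q : R -> R -> Prop) : a <= b ->
    (forall s t u, a <= s -> s <= t -> t <= u -> u <= b ->
       Q s t -> Q t u -> Q s u) ->
    (forall s, a <= s <= b -> exists2 d, 0 < d &
       forall s1 s2, a <= s1 -> s1 <= s -> s <= s2 -> s2 <= b -> s2 - s1 < d ->
         Q s1 s2) ->
  Q a b.
Proof.
move=> ab Qtrans Qloc; pose E := [set s | a <= s <= b /\ Q a s].
have Ea : E a.
  split; first by rewrite lexx.
  by have [|d d0] := Qloc a; rewrite ?lexx //; apply; rewrite ?lexx ?subrr.
have Eb : has_ubound E by exists b => s [/andP[]].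
have supE : has_sup E by split; [exists a|].
have aS : a <= sup E by exact: ub_le_sup.
have Sb : sup E <= b by apply: ge_sup; [exists a|move=> s [/andP[]]].
have [|d d0 Qd] := Qloc (sup E); first by rewrite aS.
have d20 : 0 < d / 2 by rewrite divr_gt0.
have [s Es sd] := sup_adherent d20 supE.
have sS : s <= sup E by exact: ub_le_sup.
have [/andP[as_ sb] Qs] := Es.
pose t := Num.min b (sup E + d / 3).
have tb : t <= b by rewrite ge_min lexx.
have St : sup E <= t by rewrite le_min Sb lerDl divr_ge0 // ltW.
have Et : E t.
  split; first by rewrite tb (le_trans aS).
  apply: (Qtrans a s t) => //; first exact: le_trans St.
  apply: Qd => //.
  have : t <= sup E + d / 3 by rewrite ge_min lexx orbT.
  by lra.
have tS : t <= sup E by exact: ub_le_sup.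
suff <- : t = b by have [] := Et.
rewrite /t; apply/min_idPl; rewrite leNgt; apply/negP => Sb'.
by move: tS; rewrite /t (min_idPr (ltW Sb')) => tS; lra.
Qed.

Lemma is_derive_eps_delta (g : R -> R) (s l e : R) : is_derive s 1 g l -> 0 < e ->
  exists2 d, 0 < d & forall t, `|t - s| < d -> `|g t - g s - (t - s) * l| <= e * `|t - s|.
Proof.
move=> gl e0; have dg : differentiable g s by apply/derivable1_diffP.
have [d d0 gd] := diff_eps_delta _ _ _ _ _ _ dg e0; exists d => // t /gd.
rewrite [s + _]addrC subrK deriv1E; last by [].
by rewrite derive1E derive_val.
Qed.

(** Written with an arbitrary N so that the mean value inequality runs directly in the norm v |-> N
    (F'(xs)^-1 v). *)
Definition has_derivative {n : nat} (N : 'cV[R]_n -> R) (phi : R -> 'cV[R]_n)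
    (s : R) (l : 'cV[R]_n) : Prop :=
  forall e, 0 < e -> exists2 d, 0 < d &
    forall t, `|t - s| < d -> N (phi t - phi s - (t - s) *: l) <= e * `|t - s|.

Context {n : nat} {N : 'cV[R]_n -> R} (hN : is_norm N).

(** Around each s, first-order expansions of [phi] and [g] to both sides of s give the inequality up
    to a slack proportional to the length of the interval; such slack adds up when intervals are
    joined. *)
Lemma mean_value_norm (a b : R) (phi phi' : R -> 'cV[R]_n) (g g' : R -> R) :
    a <= b ->
    (forall s, a <= s <= b -> has_derivative N phi s (phi' s)) ->
    (forall s, a <= s <= b -> is_derive s 1 g (g' s)) ->
    (forall s, a <= s <= b -> N (phi' s) <= g' s) ->
  N (phi b - phi a) <= g b - g a.
Proof.
move=> ab dphi dg phig; apply/ler_addgt0Pr => eps eps0.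
(* The factor 2 counts one error from [phi] and one from [g]; the +1 covers a = b. *)
pose e := eps / (2 * (b - a) + 1).
have D0 : 0 < 2 * (b - a) + 1 by lra.
have e0 : 0 < e by rewrite divr_gt0.
suff H : N (phi b - phi a) <= g b - g a + 2 * e * (b - a).
  apply: le_trans H _; rewrite lerD2l.
  have -> : eps = e * (2 * (b - a) + 1) by rewrite /e divfK // gt_eqF.
  have -> : e * (2 * (b - a) + 1) = 2 * e * (b - a) + e by ring.
  by rewrite lerDl ltW.
apply: (interval_cousin a b (fun s t => N (phi t - phi s) <= g t - g s + 2 * e * (t - s))) => //.
  move=> s t u _ _ _ _ H1 H2.
  have -> : phi u - phi s = (phi u - phi t) + (phi t - phi s).
    by rewrite addrA subrK.
  apply: le_trans (is_normD hN _ _) _; apply: le_trans (lerD H2 H1) _.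
  by rewrite le_eqVlt; apply/orP; left; apply/eqP; ring.
move=> s sab; have [d1 d10 H1] := dphi s sab e e0.
have [d2 d20 H2] := is_derive_eps_delta g s (g' s) e (dg s sab) e0.
exists (Num.min d1 d2); first by rewrite lt_min d10.
move=> s1 s2 as1 s1s ss2 s2b; rewrite lt_min => /andP[sd1 sd2].
have est t : `|t - s| < d1 -> `|t - s| < d2 ->
    N (phi t - phi s) <= `|t - s| * g' s + e * `|t - s| /\
    `|g t - g s - (t - s) * g' s| <= e * `|t - s|.
  move=> t1 t2; split; last exact: H2.
  have -> : phi t - phi s = (t - s) *: phi' s + (phi t - phi s - (t - s) *: phi' s).
    by rewrite [RHS]addrC subrK.
  apply: le_trans (is_normD hN _ _) _; apply: lerD; last exact: H1.
  by rewrite is_normZ // ler_wpM2l // phig.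
have [||A1 B1] := est s1; rewrite ?ler0_norm ?subr_le0 //; try lra.
have [||A2 B2] := est s2; rewrite ?ger0_norm ?subr_ge0 //; try lra.
have -> : phi s2 - phi s1 = (phi s2 - phi s) - (phi s1 - phi s).
  by rewrite opprB addrA subrK.
apply: le_trans (is_normB hN _ _) _.
move: A1 B1 A2 B2.
rewrite (@ler0_norm _ (s1 - s)) ?subr_le0 // (@ger0_norm _ (s2 - s)) ?subr_ge0 //.
rewrite !ler_norml => A1 /andP[B1 B1'] A2 /andP[B2 B2'].
by lra.
Qed.

End MeanValue.

(** * Propagation of majorants along an interval *)

Section Majorant.
Context {R : realType} {n : nat} {N : 'cV[R]_n -> R} (hN : is_norm N).
Variables (a b : R) (D : nat -> R -> 'cV[R]_n) (M : nat -> R -> R).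
Hypothesis D_deriv : forall m s, a <= s <= b -> has_derivative N (D m) s (D m.+1 s).
Hypothesis M_deriv : forall m s, a <= s <= b -> is_derive s 1 (M m) (M m.+1 s).
Hypothesis M_ge0 : forall m s, a <= s <= b -> 0 <= M m s.

(** An excess E in the derivative of order m + J is integrated J times from s1, where domination
    holds exactly, and shrinks to E (t - s1)^J / J!. *)
Lemma taylor_majorant J m s1 s2 E : a <= s1 -> s2 <= b ->
    (forall k, N (D k s1) <= M k s1) ->
    (forall t, s1 <= t <= s2 -> N (D (m + J)%N t) <= M (m + J)%N t + E) ->
  forall t, s1 <= t <= s2 -> N (D m t) <= M m t + E * (t - s1) ^+ J / J`!%:R.
Proof.
move=> as1 s2b DM1; elim: J m => [|J IH] m DE t t12.
  by rewrite expr0 fact0 mulr1 invr1 mulr1 -[m]addn0; exact: DE.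
have {}IH := IH m.+1; rewrite addSnnS in IH; have {}IH := IH DE.
have [s1t ts2] := andP t12.
(* A primitive of the bound that the induction hypothesis gives at order m + 1. *)
pose g t := M m t + E * (t - s1) ^+ J.+1 / J.+1`!%:R.
have dg s : s1 <= s <= t ->
    is_derive s 1 g (M m.+1 s + E * (s - s1) ^+ J / J`!%:R).
  move=> /andP[s1s st].
  have dM : is_derive s 1 (M m) (M m.+1 s) by apply: M_deriv; lra.
  have -> : g = M m + (E / J.+1`!%:R) \*: ((id - cst s1) ^+ J.+1).
    by apply/funext => u; rewrite /g exprfctE !fctE mulrAC.
  apply: is_derive_eq.
  rewrite subr0 factS natrM /GRing.scale /= mulr1 fctE /=; congr (_ + _).
  have J0 : J`!%:R != 0 :> R by rewrite pnatr_eq0 -lt0n fact_gt0.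
  by field; rewrite J0 nat1r pnatr_eq0.
have mv : N (D m t - D m s1) <= g t - g s1.
  apply: (mean_value_norm hN s1 t (D m) (D m.+1) g
    (fun s => M m.+1 s + E * (s - s1) ^+ J / J`!%:R) s1t _ dg).
    by move=> s /andP[s1s st]; apply: D_deriv; lra.
  by move=> s /andP[s1s st]; apply: IH; lra.
apply: le_trans (is_norm_le_add hN _ (D m s1)) _.
apply: le_trans (lerD (DM1 m) mv) _.
by rewrite /g subrr expr0n /= mulr0 mul0r addr0 addrC subrK.
Qed.

Hypothesis ab : a <= b.
Hypothesis cauchy : forall s, a <= s <= b -> exists rho C : R,
  [/\ 0 < rho, 0 <= C & forall m t, a <= t <= b -> `|t - s| < rho ->
    N (D m t) <= C * m`!%:R * rho ^- m].

(** On a short enough interval the Cauchy estimates make the Taylor excess vanish as J tends to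
    infinity; Cousin's lemma chains such intervals. *)
Lemma majorant_propagates :
  (forall m, N (D m a) <= M m a) -> forall m, N (D m b) <= M m b.
Proof.
move: (interval_cousin a b
  (fun s t => (forall m, N (D m s) <= M m s) -> forall m, N (D m t) <= M m t)).
apply=> //; first by move=> s t u _ _ _ _ st tu /st.
move=> s sab; have [rho [C [rho0 C0 DC]]] := cauchy s sab.
(* The quotient (m + J)! / J! costs a factor 2^J, so a length below rho / 4 leaves 2^-J. *)
exists (rho / 4); first by rewrite divr_gt0.
move=> s1 s2 as1 s1s ss2 s2b s12 DM1 m.
have s1s2 : s1 <= s2 by exact: le_trans ss2.
pose K := C * m`!%:R * (2 / rho) ^+ m.
have K0 : 0 <= K by rewrite !mulr_ge0 ?exprn_ge0 ?divr_ge0 // ltW.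
apply: (@ler_cvg_to _ \oo _ _ (cst (N (D m s2)))
  (fun J => M m s2 + geometric K 2^-1 J)).
- exact: cvg_cst.
- rewrite -[X in _ --> X]addr0; apply: cvgD; first exact: cvg_cst.
  by apply: cvg_geometric; rewrite ger0_norm ?invr_ge0 //; lra.
near=> J.
pose E := C * (m + J)`!%:R * rho ^- (m + J).
have E0 : 0 <= E by rewrite !mulr_ge0 ?invr_ge0 ?exprn_ge0 // ltW.
(* Since M >= 0, the Cauchy bound E alone is an admissible excess. *)
have DE t : s1 <= t <= s2 -> N (D (m + J)%N t) <= M (m + J)%N t + E.
  move=> /andP[s1t ts2]; rewrite -[leLHS]add0r lerD ?M_ge0 //; first lra.
  by apply: DC; rewrite ?ltr_norml; lra.
have := taylor_majorant J m s1 s2 E as1 s2b DM1 DE s2.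
rewrite s1s2 lexx => /(_ isT); rewrite /cst /=; move/le_trans; apply.
rewrite lerD2l.
have J0 : (J`!%:R : R) != 0 by rewrite pnatr_eq0 -lt0n fact_gt0.
have -> : E * (s2 - s1) ^+ J / J`!%:R =
    C * ((m + J) ^_ m)%:R * rho ^- m * ((s2 - s1) / rho) ^+ J.
  rewrite /E; have -> : (m + J)`! = ((m + J) ^_ m * J`!)%N.
    by rewrite -{3}[J](addKn m) ffact_fact // leq_addr.
  rewrite natrM exprMn exprVn exprD; field.
  by rewrite J0 !expf_neq0 // gt_eqF.
have -> : K * 2^-1 ^+ J = C * (2 ^+ (m + J) * m`!%:R) * rho ^- m * (4^-1) ^+ J.
  have -> : (4^-1 : R) = 2^-1 * 2^-1 by lra.
  have wz : 2 ^+ J * 2^-1 ^+ J = 1 :> R by rewrite -exprMn mulfV // expr1n.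
  transitivity (K * 2^-1 ^+ J * (2 ^+ J * 2^-1 ^+ J)); first by rewrite wz mulr1.
  rewrite /K exprD !exprMn -[rho ^- m]exprVn.
  by move: (2^-1 ^+ J) => z; ring.
apply: ler_pM.
- by rewrite !mulr_ge0 ?invr_ge0 ?exprn_ge0 // ltW.
- by rewrite exprn_ge0 // divr_ge0 ?subr_ge0 // ltW.
- rewrite ler_wpM2r ?invr_ge0 ?exprn_ge0 ?(ltW rho0) // ler_wpM2l //.
  rewrite -natrX -natrM ler_nat addnC (leq_trans (ffact_le_exp2 J m)) //.
- apply: lerXn2r; rewrite ?nnegrE ?invr_ge0 ?divr_ge0 ?subr_ge0 ?(ltW rho0) //.
  by rewrite ler_pdivrMr // mulrC ltW.
Unshelve. all: by end_near. Qed.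

End Majorant.

(** * Equivalence of norms and operator norms *)

Lemma mx_norm_tr (R : realType) m n (v : 'M[R]_(m, n)) : `|v^T| <= `|v|.
Proof.
rewrite [leLHS]/Num.norm [leRHS]/Num.norm /= !mx_normrE; apply/bigmax_leP; split.
  exact: bigmax_ge_id.
move=> [i j] _ /=; rewrite mxE; apply: (le_trans (mx_entry_le_norm _ _ _ v j i)).
by rewrite [leLHS]/Num.norm /= mx_normrE.
Qed.

Section NormEquivalence.
Context {R : realType} {n : nat} {N : 'cV[R]_n -> R} (hN : is_norm N).

(** N is continuous and positive on the compact unit sphere, so it has a positive minimum there. The
    sphere is taken among row vectors, to which [EVT_min_rV] applies. *)
Lemma mx_le_is_norm : exists2 c, 0 < c & forall v, `|v| <= c * N v.
Proof.
have trE (v : 'cV[R]_n) : `|v^T| = `|v|.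
  by apply: le_anti; rewrite mx_norm_tr -{1}(trmxK v) mx_norm_tr.
pose S := [set w : 'rV[R]_n | `|w| = 1].
have toS (v : 'cV[R]_n) : v != 0 -> S (`|v|^-1 *: v^T).
  move=> v0; rewrite /S /= normrZ normfV normr_id trE mulVf //.
  by rewrite normr_eq0.
(* An empty sphere means that every vector is 0, and any constant will do. *)
have [S0|/nonemptyPn S0] := pselect (S !=set0); last first.
  exists 1 => // v; have [->|/toS] := eqVneq v 0; last by rewrite S0.
  by rewrite normr0 (is_norm0 hN) mulr0.
have Sc : compact S.
  apply: bounded_closed_compact.
    by exists 1; split=> // x x1 w; rewrite /S /= => w1; rewrite w1 ltW.
  have -> : S = (fun w : 'rV[R]_n => `|w|) @^-1` [set 1] by [].
  by apply: closed_comp => [w _|]; [exact: norm_continuous|exact: closed_eq].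
have [c c0 Nc] := is_norm_le_mx hN.
have N1 (u v : 'cV[R]_n) : N u - N v <= N (u - v).
  by rewrite lerBlDl is_norm_le_add.
have Ncont : continuous (fun w : 'rV[R]_n => N w^T).
  move=> w; apply/(@cvgrPdist_le _ _ _ _ (nbhs_filter w)).
  move=> e e0; near=> w'.
  apply: (@le_trans _ _ (N (w - w')^T)).
    rewrite ler_norml linearB /= N1 andbT lerNl opprB.
    by rewrite (is_norm_distC hN) N1.
  apply: le_trans (Nc _) _; rewrite -ler_pdivlMl // mulrC.
  apply: le_trans (mx_norm_tr _ _ _ _) _.
  near: w'; apply: cvgr_dist_le; last by rewrite divr_gt0.
  exact: cvg_id.
have [w] := EVT_min_rV S0 Sc (continuous_subspaceT Ncont).
rewrite inE => w1 wmin; have w0 : 0 < N w^T.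
  rewrite lt_neqAle is_norm_ge0 // andbT eq_sym; apply/eqP => /(is_norm_eq0 hN).
  move=> wT0; have := w1; rewrite /S /= -(trmxK w) trE wT0 normr0 => /eqP.
  by rewrite eq_sym oner_eq0.
exists (N w^T)^-1; first by rewrite invr_gt0.
move=> v; have [->|v0] := eqVneq v 0.
  by rewrite normr0 (is_norm0 hN) mulr0.
have := wmin _ (mem_set (toS v v0)).
rewrite linearZ /= trmxK is_normZ // normfV normr_id.
by rewrite ler_pdivlMl ?normr_gt0 // ler_pdivlMl // mulrC.
Unshelve. all: by end_near. Qed.

End NormEquivalence.

Section OperatorNorms.
Context {R : realType} {n : nat} {N : 'cV[R]_n -> R} (hN : is_norm N).

(** This covers v = 0 as well, since the inverse of 0 is 0. *)
Lemma unit_scaling (v : 'cV[R]_n) :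
  v = N v *: ((N v)^-1 *: v) /\ N ((N v)^-1 *: v) <= 1.
Proof.
rewrite is_normZ // normfV ger0_norm ?is_norm_ge0 // scalerA.
have [Nv0|Nv0] := eqVneq (N v) 0.
  by rewrite Nv0 !mul0r scale0r mulr0 ler01; split=> //; exact: is_norm_eq0 Nv0.
by rewrite mulfV // mulVf // scale1r lexx.
Qed.

(** This boundedness makes the [sup] in [opnorm] a genuine supremum. *)
Lemma mulmx_bounded (A : 'M[R]_n) : exists2 c, 0 <= c & forall v, N (A *m v) <= c * N v.
Proof.
have [c c0 Nc] := mx_le_is_norm hN.
exists ((\sum_(j < n) N (A *m delta_mx j 0)) * c).
  by rewrite mulr_ge0 ?(ltW c0) // sumr_ge0 // => j _; exact: is_norm_ge0.
move=> v; have {1}-> : v = \sum_j v j 0 *: (delta_mx j 0 : 'cV[R]_n).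
  by rewrite [LHS]matrix_sum_delta; apply: eq_bigr => j _; rewrite big_ord1.
rewrite mulmx_sumr; apply: le_trans (is_norm_sum hN _ _ _) _.
rewrite -mulrA mulr_suml; apply: ler_sum => j _.
rewrite -scalemxAr is_normZ // mulrC ler_wpM2l ?is_norm_ge0 //.
by apply: le_trans (Nc v); exact: mx_entry_le_norm.
Qed.

Lemma le_opnorm (A : 'M[R]_n) v : N (A *m v) <= opnorm N A * N v.
Proof.
have [vE Nw] := unit_scaling v.
rewrite {1}vE -scalemxAr is_normZ // ger0_norm ?is_norm_ge0 // mulrC.
rewrite ler_wpM2r ?is_norm_ge0 //; apply: ub_le_sup; last by exists ((N v)^-1 *: v).
have [c c0 Ac] := mulmx_bounded A.
exists c => _ [w /= w1 <-]; apply: le_trans (Ac w) _.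
by rewrite -[leRHS]mulr1 ler_wpM2l.
Qed.

(** The bound C ensures that the [sup] is a genuine supremum; homogeneity reduces arbitrary
    arguments to the unit ball. *)
Lemma le_mopnorm m (T : ('I_m -> 'cV[R]_n) -> 'cV[R]_n) (C : R) :
    (forall (c : 'I_m -> R) v, T (fun i => c i *: v i) = (\prod_i c i) *: T v) ->
    (forall v, (forall i, N (v i) <= 1) -> N (T v) <= C) ->
  0 <= mopnorm N T /\ forall v, N (T v) <= mopnorm N T * \prod_i N (v i).
Proof.
move=> TZ TC.
have Tw w : (forall i, N (w i) <= 1) -> N (T w) <= mopnorm N T.
  move=> w1; apply: ub_le_sup; last by exists w.
  by exists C => _ [u /= u1 <-]; exact: TC.
split.
  apply: le_trans (Tw (fun=> 0) _); first exact: is_norm_ge0.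
  by move=> i; rewrite is_norm0.
move=> v.
have vE : v = fun i => N (v i) *: ((N (v i))^-1 *: v i).
  by apply/funext => i; have [] := unit_scaling (v i).
rewrite {1}vE TZ is_normZ // ger0_norm; last first.
  by apply: prodr_ge0 => i _; exact: is_norm_ge0.
rewrite mulrC ler_wpM2r //; first by apply: prodr_ge0 => i _; exact: is_norm_ge0.
by apply: Tw => i; have [] := unit_scaling (v i).
Qed.

Variables (Omega : set 'cV[R]_n) (F : 'cV[R]_n -> 'cV[R]_n) (xs : 'cV[R]_n).
Hypotheses (Omega_open : open Omega) (xs_Omega : Omega xs).
Hypothesis F_analytic : forall x, Omega x -> analytic_at F x.

Lemma nderiv_le_gamma (gamma : R) : gamma%:E = smale_gamma N F xs ->
  forall m (v : 'I_m.+2 -> 'cV[R]_n),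
    N (invmx (jac F xs) *m nderiv F xs v) <=
      m.+2`!%:R * gamma ^+ m.+1 * \prod_i N (v i).
Proof.
move=> gE m v; set A := invmx _.
pose T (v : 'I_m.+2 -> 'cV[R]_n) : 'cV[R]_n :=
  (m.+2`!%:R : R)^-1 *: (A *m nderiv F xs v).
have [r [rho [C [r0 rho0 C0 _ Fb]]]] := analytic_nderiv _ _ (F_analytic _ xs_Omega).
have {}Fb v' := Fb m.+2 v' xs _; rewrite subrr normr0 in Fb.
have [c1 c10 Nc1] := is_norm_le_mx hN.
have [c2 c20 Nc2] := mx_le_is_norm hN.
have [c3 c30 Ac3] := mulmx_bounded A.
have f0 : 0 < (m.+2`!%:R : R) by rewrite ltr0n fact_gt0.
have TZ (c : 'I_m.+2 -> R) w : T (fun i => c i *: w i) = (\prod_i c i) *: T w.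
  rewrite /T (nderiv_scale _ _ Omega_open F_analytic _ _ _ _ xs_Omega).
  by rewrite -scalemxAr !scalerA mulrC.
(* A crude bound from the Cauchy estimate; it serves only to make the supremum finite. *)
have TC w : (forall i, N (w i) <= 1) ->
    N (T w) <= m.+2`!%:R^-1 * (c3 * (c1 * (C * m.+2`!%:R * rho ^- m.+2 * c2 ^+ m.+2))).
  move=> w1; rewrite /T is_normZ // ger0_norm ?invr_ge0 ?(ltW f0) //.
  rewrite ler_wpM2l ?invr_ge0 ?(ltW f0) //.
  apply: le_trans (Ac3 _) _; rewrite ler_wpM2l //.
  apply: le_trans (Nc1 _) _; rewrite ler_wpM2l ?(ltW c10) //.
  apply: le_trans (Fb r0 _) _; rewrite ler_wpM2l //.
    by rewrite !mulr_ge0 ?invr_ge0 ?exprn_ge0 ?(ltW rho0).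
  rewrite -[m.+2 in leRHS]card_ord -prodr_const; apply: ler_prod => i _.
  rewrite normr_ge0 /=; apply: le_trans (Nc2 _) _.
  by rewrite -[leRHS]mulr1 ler_wpM2l ?(ltW c20).
have [s0 Ts] := le_mopnorm _ _ _ TZ TC.
have : N (T v) <= gamma ^+ m.+1 * \prod_i N (v i).
  apply: le_trans (Ts v) _; rewrite ler_wpM2r //.
    by apply: prodr_ge0 => i _; exact: is_norm_ge0.
  (* At order m + 2 the supremum defining gamma takes the root of degree m + 1, undone below by a
     power. *)
  have : mopnorm N T `^ (m.+1%:R^-1) <= gamma.
    by rewrite -lee_fin gE; apply: ereal_sup_ubound; exists m.+2.
  move: (mopnorm N T) s0 => s s0 sg.
  have -> : s = (s `^ (m.+1%:R^-1)) ^+ m.+1.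
    by rewrite -powR_mulrn ?powR_ge0 // -powRrM mulVf ?pnatr_eq0 // powRr1.
  have sg0 := powR_ge0 s m.+1%:R^-1.
  by apply: lerXn2r => //; rewrite nnegrE // (le_trans sg0).
rewrite /T is_normZ // ger0_norm ?invr_ge0 ?(ltW f0) // ler_pdivrMl //.
by rewrite mulrA.
Qed.

End OperatorNorms.

(** * Estimates along a segment *)

Section GeometricMajorant.
Context {R : realType}.
Variables (u c : R).

Lemma is_derive_geometric (s : R) : u * s < 1 ->
  is_derive s 1 (fun s => (1 - u * s)^-1) (u * (1 - u * s)^-1 ^+ 2).
Proof.
move=> us1; have us0 : 1 - u * s != 0 by rewrite subr_eq0 eq_sym lt_eqF.
pose f := cst 1 - u \*: (id : R -> R).
have fE : f = fun s => 1 - u * s by apply/funext => t; rewrite /f !fctE.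
have df : is_derive s 1 f (- u).
  by apply: is_derive_eq; rewrite sub0r /GRing.scale /= mulr1.
have fs0 : f s != 0 by rewrite fE.
have dfV : derivable (fun y => (f y)^-1) s 1 by apply: derivableV.
have -> : (fun s => (1 - u * s)^-1) = (fun y => (f y)^-1) by rewrite fE.
apply: DeriveDef; first exact: dfV.
have df1 : derivable f s 1 by case: df.
rewrite (deriveV fs0 df1) derive_val fE /GRing.scale /=.
by rewrite exprVn mulrNN mulrC.
Qed.

(** The m-th derivative of s |-> c / (1 - u s)^2. *)
Definition geometric_majorant (m : nat) (s : R) : R :=
  c * m.+1`!%:R * u ^+ m * (1 - u * s)^-1 ^+ m.+2.

Lemma geometric_majorant_deriv m s : u * s < 1 ->
  is_derive s 1 (geometric_majorant m) (geometric_majorant m.+1 s).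
Proof.
move=> us1; have dg := is_derive_geometric s us1.
have -> : geometric_majorant m =
    (c * m.+1`!%:R * u ^+ m) \*: ((fun s => (1 - u * s)^-1) ^+ m.+2).
  by apply/funext => t; rewrite exprfctE.
apply: is_derive_eq; rewrite /geometric_majorant /GRing.scale /=.
by rewrite [m.+2`!]factS natrM !exprS expr0; set w := (1 - u * s)^-1; ring.
Qed.

Lemma geometric_majorant_ge0 m s : 0 <= u -> 0 <= c -> u * s < 1 ->
  0 <= geometric_majorant m s.
Proof.
move=> u0 c0 us1; have w0 : 0 <= (1 - u * s)^-1 by rewrite invr_ge0 subr_ge0 ltW.
apply: mulr_ge0; last exact: exprn_ge0.
by apply: mulr_ge0; [exact: mulr_ge0|exact: exprn_ge0].
Qed.

End GeometricMajorant.

Section HasDerivative.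
Context {R : realType} {n : nat} {N : 'cV[R]_n -> R} (hN : is_norm N).

Lemma has_derivative_line (G : 'cV[R]_n -> 'cV[R]_n) (x h : 'cV[R]_n) (s : R) :
  differentiable G (x + s *: h) ->
  has_derivative N (fun t => G (x + t *: h)) s ('d G (x + s *: h) h).
Proof.
move=> dG e e0; have [c c0 Nc] := is_norm_le_mx hN.
(* Dividing by |h| + 1 instead of |h| admits h = 0. *)
have h0 : 0 < `|h| + 1 by rewrite ltr_wpDl.
have e1 : 0 < e / (c * (`|h| + 1)) by rewrite divr_gt0 // mulr_gt0.
have [d d0 dd] := diff_eps_delta _ _ _ _ _ _ dG e1.
exists (d / (`|h| + 1)); first by rewrite divr_gt0.
move=> t; rewrite ltr_pdivlMr // => td.
have hk : `|(t - s) *: h| <= `|t - s| * (`|h| + 1).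
  by rewrite normrZ ler_wpM2l // lerDl.
have := dd _ (le_lt_trans hk td).
have -> : x + s *: h + (t - s) *: h = x + t *: h.
  by rewrite -addrA -scalerDl addrC [s + _]addrC subrK addrC.
rewrite linearZ /= => H; apply: le_trans (Nc _) _.
rewrite -ler_pdivlMl //; apply: le_trans H _.
apply: le_trans (ler_wpM2l (ltW e1) hk) _.
rewrite le_eqVlt; apply/orP; left; apply/eqP; field.
by rewrite !gt_eqF.
Qed.

Lemma has_derivative_subZ (phi : R -> 'cV[R]_n) s l w :
  has_derivative N phi s l ->
  has_derivative N (fun t => phi t - t *: w) s (l - w).
Proof.
move=> dphi e e0; have [d d0 dd] := dphi e e0; exists d => // t td.
have -> : phi t - t *: w - (phi s - s *: w) - (t - s) *: (l - w) =
    phi t - phi s - (t - s) *: l.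
  by rewrite scalerBr [(t - s) *: w]scalerBl; apply/matrixP => i j; rewrite !mxE; ring.
exact: dd.
Qed.

End HasDerivative.

Section SegmentEstimates.
Context {R : realType} {n : nat} {N : 'cV[R]_n -> R} (hN : is_norm N).
Variables (Omega : set 'cV[R]_n) (F : 'cV[R]_n -> 'cV[R]_n) (xs : 'cV[R]_n).
Hypotheses (Omega_open : open Omega) (xs_Omega : Omega xs).
Hypothesis F_analytic : forall x, Omega x -> analytic_at F x.
Hypothesis F'xs_inv : jac F xs \in unitmx.
Variable gamma : R.
Hypotheses (gammaE : gamma%:E = smale_gamma N F xs) (gamma_ge0 : 0 <= gamma).
Variable h : 'cV[R]_n.
Hypothesis segment_Omega : forall s, 0 <= s <= 1 -> Omega (xs + s *: h).
Hypothesis h_small : gamma * N h < 1.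

Let N' (v : 'cV[R]_n) := N (invmx (jac F xs) *m v).

Let hN' : is_norm N'.
Proof.
split=> [v w|c v|v v0]; rewrite /N'.
- by rewrite mulmxDr is_normD.
- by rewrite -scalemxAr is_normZ.
- by rewrite -(mulKVmx F'xs_inv v) (is_norm_eq0 hN _ v0) mulmx0.
Qed.

Let u := gamma * N h.

Let u_ge0 : 0 <= u. Proof. by rewrite mulr_ge0 ?is_norm_ge0. Qed.

Let us_lt1 s : 0 <= s <= 1 -> u * s < 1.
Proof.
move=> /andP[s0 s1]; apply: le_lt_trans h_small.
by rewrite -[leRHS]mulr1 ler_wpM2l.
Qed.

(* With these arguments, nderiv F y is the m-th derivative in the direction h of
   y |-> F'(y) v: the derivative taken first sits in the last slot. *)
Definition line_args (v : 'cV[R]_n) m : 'I_m.+1 -> 'cV[R]_n :=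
  fun i => if (i == m :> nat) then v else h.

Lemma prod_line_args v m (f : 'cV[R]_n -> R) :
  \prod_(i < m.+1) f (line_args v m i) = f h ^+ m * f v.
Proof.
rewrite big_ord_recr /= /line_args /= eqxx; congr (_ * _).
under eq_bigr => i _ do rewrite ltn_eqF //.
by rewrite prodr_const card_ord.
Qed.

Let D v m s := nderiv F (xs + s *: h) (line_args v m).

Let D_deriv v m s : 0 <= s <= 1 -> has_derivative N' (D v m) s (D v m.+1 s).
Proof.
move=> s01; have [r [rho [C [r0 _ _ dF _]]]] := analytic_nderiv _ _ (F_analytic _ (segment_Omega s s01)).
have /(has_derivative_line hN' _ xs h s) : differentiable (fun y => nderiv F y (line_args v m)) (xs + s *: h).
  by apply: dF; rewrite subrr normr0.
(* By computation, [line_args v m.+1] has h in slot 0 and [line_args v m] in the remaining slots. *)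
exact.
Qed.

Let D_cauchy v s : 0 <= s <= 1 -> exists rho C : R,
  [/\ 0 < rho, 0 <= C & forall m t, 0 <= t <= 1 -> `|t - s| < rho ->
    N' (D v m t) <= C * m`!%:R * rho ^- m].
Proof.
move=> s01.
have [r [rho [C [r0 rho0 C0 _ Fb]]]] :=
  analytic_nderiv _ _ (F_analytic _ (segment_Omega s s01)).
have [c c0 Nc] := is_norm_le_mx hN'.
have h0 : 0 < `|h| + 1 by rewrite ltr_wpDl.
(* The 2 absorbs m + 1 <= 2^m from (m+1)! = (m+1) m!, and |h| + 1 absorbs |h|^m. *)
pose rho' := rho / (2 * (`|h| + 1)).
have rho'0 : 0 < rho' by rewrite divr_gt0 // mulr_gt0.
pose C' := c * C * rho^-1 * `|v|.
have C'0 : 0 <= C' by rewrite !mulr_ge0 ?invr_ge0 ?(ltW c0) ?(ltW rho0).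
exists (Num.min (r / (`|h| + 1)) rho'), C'; split=> //.
  by rewrite lt_min rho'0 divr_gt0.
move=> m t _; rewrite lt_min => /andP[tr _].
apply: (@le_trans _ _ (C' * m`!%:R * rho' ^- m)); last first.
  apply: ler_wpM2l; first exact: mulr_ge0.
  rewrite -!exprVn; apply: lerXn2r.
  - by rewrite nnegrE invr_ge0 ltW.
  - by rewrite nnegrE invr_ge0 le_min !ltW // divr_gt0.
  - rewrite lef_pV2 ?posrE ?rho'0 ?lt_min ?rho'0 ?divr_gt0 //.
    by rewrite ge_min lexx orbT.
apply: le_trans (Nc _) _.
have : `|xs + t *: h - (xs + s *: h)| < r.
  rewrite opprD addrACA subrr add0r -scalerBl normrZ.
  apply: le_lt_trans (_ : `|t - s| * (`|h| + 1) < r).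
    by rewrite ler_wpM2l // lerDl.
  by rewrite -ltr_pdivlMr.
move=> /(Fb _ (line_args v m)); rewrite (prod_line_args v m (fun w => `|w|)) => H.
apply: le_trans (ler_wpM2l (ltW c0) H) _.
have -> : c * (C * m.+1`!%:R * rho ^- m.+1 * (`|h| ^+ m * `|v|)) =
    C' * (m.+1%:R * m`!%:R * (`|h| ^+ m * rho ^- m)).
  by rewrite factS natrM exprS /C' invfM; ring.
have -> : C' * m`!%:R * rho' ^- m =
    C' * (2 ^+ m * m`!%:R * ((`|h| + 1) ^+ m * rho ^- m)).
  by rewrite /rho' -exprVn invf_div !exprMn -exprVn; ring.
apply: ler_wpM2l => //; apply: ler_pM.
- exact: mulr_ge0.
- by rewrite mulr_ge0 ?invr_ge0 ?exprn_ge0 ?(ltW rho0).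
- by rewrite ler_wpM2r // -natrX ler_nat ltn_expl.
- rewrite ler_wpM2r ?invr_ge0 ?exprn_ge0 ?(ltW rho0) //.
  by apply: lerXn2r; rewrite ?nnegrE ?(ltW h0) // lerDl.
Qed.

(** gamma governs derivatives of F of order at least 2, that is m >= 1; for m = 0 the matrix cancels
    against its inverse and both sides equal N v. *)
Let D_gamma v m : N' (D v m 0) <= geometric_majorant u (N v) m 0.
Proof.
rewrite /geometric_majorant mulr0 subr0 invr1 expr1n mulr1 /D scale0r addr0.
case: m => [|m].
  rewrite /N' /= -mul_jac mulKmx // /line_args eqxx expr0 !mulr1.
  exact: lexx.
apply: le_trans (nderiv_le_gamma hN _ _ _ Omega_open xs_Omega F_analytic _ gammaE _ _) _.
by rewrite (prod_line_args v m.+1 N) /u exprMn le_eqVlt; apply/orP; left; apply/eqP; ring.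
Qed.

Let D_majorant v m s : 0 <= s <= 1 -> N' (D v m s) <= geometric_majorant u (N v) m s.
Proof.
move=> /andP[s0 s1]; have sub t : 0 <= t <= s -> 0 <= t <= 1.
  by move=> /andP[-> /le_trans]; exact.
apply: (majorant_propagates hN' 0 s (D v) (geometric_majorant u (N v)) _ _ _ s0); last exact: D_gamma.
- by move=> k t /sub; exact: D_deriv.
- by move=> k t /sub/us_lt1; exact: geometric_majorant_deriv.
- move=> k t /sub/us_lt1; apply: geometric_majorant_ge0 => //.
  exact: is_norm_ge0.
- move=> t /sub/(D_cauchy v)[rho [C [rho0 C0 DC]]]; exists rho, C; split=> //.
  by move=> k t' /sub; exact: DC.
Qed.

Let x := xs + h.

Let x_line : xs + 1 *: h = x. Proof. by rewrite scale1r. Qed.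

Let D0 v s : D v 0 s = jac F (xs + s *: h) *m v.
Proof. by rewrite mul_jac. Qed.

Let D0_diff v s t : 0 <= s -> s <= t -> t <= 1 ->
  N' (D v 0 t - D v 0 s) <= N v * ((1 - u * t)^-1 ^+ 2 - (1 - u * s)^-1 ^+ 2).
Proof.
move=> s0 st t1; have sub w : s <= w <= t -> 0 <= w <= 1 by lra.
have -> : N v * ((1 - u * t)^-1 ^+ 2 - (1 - u * s)^-1 ^+ 2) =
    geometric_majorant u (N v) 0 t - geometric_majorant u (N v) 0 s.
  by rewrite /geometric_majorant expr0 !mulr1 mulrBr.
apply: (mean_value_norm hN' s t (D v 0) (D v 1) _ (geometric_majorant u (N v) 1) st).
- by move=> w /sub; exact: D_deriv.
- by move=> w /sub/us_lt1; exact: geometric_majorant_deriv.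
- by move=> w /sub; exact: D_majorant.
Qed.

Lemma jac_perturbation v : N (invmx (jac F xs) *m (jac F x *m v) - v) <=
  ((1 - u)^-1 ^+ 2 - 1) * N v.
Proof.
have := D0_diff v 0 1 (lexx 0) ler01 (lexx 1).
rewrite (D0 v 1) (D0 v 0) x_line scale0r addr0 /N' mulmxBr.
rewrite [X in N (_ - X)](mulKmx F'xs_inv v).
by rewrite mulr0 mulr1 subr0 invr1 expr1n mulrC.
Qed.

Hypothesis Fxs : F xs = 0.

(** F'(x) h - F(x) is the integral over [0, 1] of (F'(x) - F'(xs + s h)) h, whose integrand
    [D0_diff] bounds. *)
Lemma taylor_remainder : N (invmx (jac F xs) *m (jac F x *m h - F x)) <=
  N h * u * (1 - u)^-1 ^+ 2.
Proof.
(* s / (1 - u s) is a primitive of (1 - u s)^-2 that avoids dividing by u. *)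
pose g s := s * (N h * (1 - u)^-1 ^+ 2) - N h * (s * (1 - u * s)^-1).
have dF s : 0 <= s <= 1 -> has_derivative N' (fun t => F (xs + t *: h)) s (D h 0 s).
  move=> s01; have [r [rho [C [r0 _ _ dF _]]]] :=
    analytic_nderiv _ _ (F_analytic _ (segment_Omega s s01)).
  apply: (has_derivative_line hN'); apply: (dF 0 (fun=> 0)).
  by rewrite subrr normr0.
have g01 : g 1 - g 0 = N h * u * (1 - u)^-1 ^+ 2.
  have u1 : 1 - u != 0 by rewrite subr_eq0 eq_sym lt_eqF.
  by rewrite /g !mulr1 !mul0r mulr0 subr0 mul1r; field.
rewrite -g01.
have -> : N (invmx (jac F xs) *m (jac F x *m h - F x)) =
    N' ((F (xs + 1 *: h) - 1 *: D h 0 1) - (F (xs + 0 *: h) - 0 *: D h 0 1)).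
  rewrite (D0 h 1) x_line !scale0r addr0 Fxs subrr subr0 scale1r.
  by rewrite -(is_normN hN') opprB.
apply: (mean_value_norm hN' 0 1 (fun t => F (xs + t *: h) - t *: D h 0 1)
  (fun s => D h 0 s - D h 0 1) g
  (fun s => N h * ((1 - u)^-1 ^+ 2 - (1 - u * s)^-1 ^+ 2)) ler01).
- by move=> s s01; apply: has_derivative_subZ; exact: dF.
- move=> s /us_lt1 us1; have dw := is_derive_geometric u s us1.
  have -> : g = (N h * (1 - u)^-1 ^+ 2) \*: (id : R -> R) -
      N h \*: ((id : R -> R) * (fun s => (1 - u * s)^-1)).
    by apply/funext => t; rewrite !fctE /g [t * _]mulrC.
  apply: is_derive_eq; rewrite /GRing.scale /= !mulr1.
  have us0 : 1 - u * s != 0 by rewrite subr_eq0 eq_sym lt_eqF.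
  have u1 : 1 - u != 0 by rewrite subr_eq0 eq_sym lt_eqF.
  by field; rewrite us0.
move=> s /andP[s0 s1]; rewrite (is_norm_distC hN').
by have := D0_diff h s 1 s0 s1 (lexx 1); rewrite mulr1.
Qed.

End SegmentEstimates.

(** * The Newton-like iteration *)

Section Contraction.
Context {R : realType}.
Implicit Types a b u : R.

(** The threshold is the smaller root of 2 b u^2 - (a + 4 b) u + b, and positivity of this quadratic
    is a u < b (2 (1 - u)^2 - 1). *)
Lemma small_root_bounds a b u : 0 <= a -> 0 < b -> 0 <= u ->
    u < (a + 4 * b - Num.sqrt ((a + 4 * b) ^+ 2 - 8 * b ^+ 2)) / (4 * b) ->
  [/\ u < 1, 0 < 2 * (1 - u) ^+ 2 - 1 & a * (u / (2 * (1 - u) ^+ 2 - 1)) < b].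
Proof.
move=> a0 b0 u0; set d := (_ ^+ 2 - _); set s := Num.sqrt d.
have d_ge : a ^+ 2 <= d by rewrite /d; nra.
have s2 : s ^+ 2 = d by rewrite sqr_sqrtr // (le_trans _ d_ge) // sqr_ge0.
have s0 : 0 <= s by exact: sqrtr_ge0.
(* With a <= s the threshold is at most 1, and [us] can be squared. *)
have as_ : a <= s by rewrite -(@ler_pXn2r _ 2) ?nnegrE ?s2.
rewrite ltr_pdivlMr ?mulr_gt0 // => us.
have u1 : u < 1 by rewrite -(ltr_pM2r (x := 4 * b)) ?mulr_gt0 //; lra.
have z : d < (a + 4 * b - u * (4 * b)) ^+ 2.
  by rewrite -s2 ltr_pXn2r ?nnegrE //; lra.
have q : a * u < b * (2 * (1 - u) ^+ 2 - 1).
  rewrite -(ltr_pM2r (x := 8 * b)) ?mulr_gt0 //.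
  by move: z; rewrite /d; lra.
have den : 0 < 2 * (1 - u) ^+ 2 - 1.
  by rewrite -(pmulr_rgt0 _ b0); apply: le_lt_trans q; rewrite mulr_ge0.
by split=> //; rewrite mulrA ltr_pdivrMr.
Qed.

Lemma newton_factor_le u v : 0 <= u -> u <= v -> v < 1 ->
  0 < 2 * (1 - v) ^+ 2 - 1 ->
  u / (2 * (1 - u) ^+ 2 - 1) <= v / (2 * (1 - v) ^+ 2 - 1).
Proof.
move=> u0 uv v1 dv.
have duv : 2 * (1 - v) ^+ 2 - 1 <= 2 * (1 - u) ^+ 2 - 1 by nra.
apply: ler_pM => //; first by rewrite invr_ge0; lra.
by rewrite lef_pV2 ?posrE //; lra.
Qed.

End Contraction.

Lemma unitmx_of_kernel (K : fieldType) n (J : 'M[K]_n) :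
  (forall v : 'cV[K]_n, J *m v = 0 -> v = 0) -> J \in unitmx.
Proof.
move=> Jinj; rewrite -unitmx_tr unitmxE unitfE; apply/det0P => -[v v0 vJ].
by move/eqP: v0; apply; rewrite -(trmxK v) (Jinj v^T) ?trmx0 // -(trmxK J) -trmx_mul vJ trmx0.
Qed.

Section NewtonLikeStep.
Context {R : realType} {n : nat} {N : 'cV[R]_n -> R} (hN : is_norm N).

Lemma opnorm_ge0 (A : 'M[R]_n) : 0 <= opnorm N A.
Proof.
have [c c0 Ac] := mulmx_bounded hN A.
apply: ub_le_sup; last by exists 0; rewrite /= ?mulmx0 ?is_norm0.
by exists c => _ [w /= w1 <-]; apply: le_trans (Ac w) _; rewrite -[leRHS]mulr1 ler_wpM2l.
Qed.

Variables (Omega : set 'cV[R]_n) (F : 'cV[R]_n -> 'cV[R]_n) (xs : 'cV[R]_n).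
Hypotheses (Omega_open : open Omega) (xs_Omega : Omega xs).
Hypothesis F_analytic : forall x, Omega x -> analytic_at F x.
Hypothesis F'xs_inv : jac F xs \in unitmx.
Hypothesis Fxs : F xs = 0.
Variable gamma : R.
Hypotheses (gammaE : gamma%:E = smale_gamma N F xs) (gamma_ge0 : 0 <= gamma).
Variables x h : 'cV[R]_n.
Hypothesis xE : xs + h = x.
Let u := gamma * N h.
Hypothesis segment_Omega : forall s, 0 <= s <= 1 -> Omega (xs + s *: h).
Hypothesis u_lt1 : u < 1.
Hypothesis u_den : 0 < 2 * (1 - u) ^+ 2 - 1.

Let w2 : (1 - u)^-1 ^+ 2 < 2.
Proof.
rewrite exprVn invf_plt ?posrE ?exprn_gt0 ?subr_gt0 //.
by move: u_den; set d := (1 - u) ^+ 2 => ?; lra.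
Qed.

Let jac_pert v : N (invmx (jac F xs) *m (jac F x *m v) - v) <=
  ((1 - u)^-1 ^+ 2 - 1) * N v.
Proof.
rewrite -{1}xE.
exact: (jac_perturbation hN _ _ _ Omega_open xs_Omega F_analytic F'xs_inv _ gammaE
  gamma_ge0 _ segment_Omega u_lt1 v).
Qed.

(** If F'(x) v = 0, the perturbation bound reads N v <= ((1 - u)^-2 - 1) N v with a factor below 1,
    so v = 0. *)
Lemma jac_unit : jac F x \in unitmx.
Proof.
apply: unitmx_of_kernel => v Jv0; apply: (is_norm_eq0 hN).
have := jac_pert v; rewrite Jv0 mulmx0 sub0r is_normN // => H.
apply: le_anti; rewrite is_norm_ge0 // andbT.
have : (2 - (1 - u)^-1 ^+ 2) * N v <= 0.
  by move: H; set w := _ ^+ 2; lra.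
by rewrite pmulr_rle0 // subr_gt0.
Qed.

(** The error y satisfies F'(x) y = F'(x) h - F(x). With w = (1 - u)^-2, the perturbation bound
    gives (2 - w) N y <= u w N h, and u w / (2 - w) is the stated factor. *)
Lemma newton_error :
  N (h - invmx (jac F x) *m F x) <= u / (2 * (1 - u) ^+ 2 - 1) * N h.
Proof.
have [y <- Jy] : exists2 y, y = h - invmx (jac F x) *m F x &
    jac F x *m y = jac F x *m h - F x.
  by eexists; [reflexivity|rewrite mulmxBr [X in _ - X = _](mulKVmx jac_unit)].
have T : N (invmx (jac F xs) *m (jac F x *m y)) <= N h * u * (1 - u)^-1 ^+ 2.
  rewrite Jy -xE.
  exact: (taylor_remainder hN _ _ _ Omega_open xs_Omega F_analytic F'xs_inv _ gammaE
    gamma_ge0 _ segment_Omega u_lt1 Fxs).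
have H : (2 - (1 - u)^-1 ^+ 2) * N y <= N h * u * (1 - u)^-1 ^+ 2.
  have P := jac_pert y; rewrite (is_norm_distC hN) in P.
  have A := is_norm_le_add hN y (invmx (jac F xs) *m (jac F x *m y)).
  by move: T P A; set w := _ ^+ 2; lra.
have u1 : 1 - u != 0 by rewrite subr_eq0 eq_sym lt_eqF.
rewrite -ler_pdivlMl ?subr_gt0 // in H; apply: le_trans H _.
rewrite le_eqVlt; apply/orP; left; apply/eqP; field.
by rewrite u1 gt_eqF.
Qed.

Lemma newton_like_step (omega1 omega2 vtheta theta : R) (Bx P : 'M[R]_n)
    (r S : 'cV[R]_n) : 0 <= omega1 -> 0 <= vtheta -> 0 <= theta ->
    Bx *m S = - F x + r -> Bx \in unitmx -> P \in unitmx ->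
    opnorm N (invmx Bx *m jac F x) <= omega1 ->
    opnorm N (invmx Bx *m jac F x - 1%:M) <= omega2 ->
    N (P *m r) <= theta * N (P *m F x) ->
    theta * cond N (P *m jac F x) <= vtheta ->
  N (h + S) <= (omega1 * (1 + vtheta) * (u / (2 * (1 - u) ^+ 2 - 1))
                + omega1 * vtheta + omega2) * N h.
Proof.
move=> o1 vt0 th0 BS Bu Pu B1 B2 Pr thc.
have Ju := jac_unit; have := newton_error.
move: (jac F x) (F x) BS Ju B1 B2 Pr thc => J f BS Ju B1 B2 Pr thc.
set y := h - invmx J *m f => Ny.
have fE : f = J *m (h - y) by rewrite /y opprB addrC subrK mulKVmx.
have PJu : P *m J \in unitmx by rewrite unitmx_mul Pu.
(* z is J^-1 r, written through P J so that the condition number of P J appears. *)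
pose z := invmx (P *m J) *m (P *m r).
have rE : r = J *m z.
  by rewrite /z -[LHS](mulKmx Pu) -[in LHS](mulKVmx PJu (P *m r)) -!mulmxA mulKmx.
have Nz : N z <= vtheta * (N h + N y).
  apply: le_trans (le_opnorm hN _ _) _.
  apply: le_trans (ler_wpM2l (opnorm_ge0 _) Pr) _.
  rewrite fE mulmxA mulrA.
  have oth0 : 0 <= opnorm N (invmx (P *m J)) * theta by rewrite mulr_ge0 ?opnorm_ge0.
  apply: le_trans (ler_wpM2l oth0 (le_opnorm hN _ _)) _.
  have -> : opnorm N (invmx (P *m J)) * theta * (opnorm N (P *m J) * N (h - y)) =
    theta * cond N (P *m J) * N (h - y) by rewrite /cond; ring.
  apply: ler_pM => //; last exact: is_normB.
    by rewrite /cond !mulr_ge0 ?opnorm_ge0.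
  exact: is_norm_ge0.
pose C := invmx Bx *m J.
(* The new error splits into the exact Newton error, the residual, and the defect of B as an
   approximation of F'(x). *)
have SE : h + S = C *m y + C *m z - (C - 1%:M) *m h.
  have -> : S = - (C *m (h - y)) + C *m z.
    by rewrite -[LHS](mulKmx Bu) BS {1}fE {1}rE mulmxDr mulmxN /C !mulmxA.
  by rewrite mulmxBr mulmxBl mul1mx; apply/matrixP => i j; rewrite !mxE; ring.
have H1 : N (C *m y) <= omega1 * N y.
  apply: le_trans (le_opnorm hN _ _) _.
  by rewrite ler_wpM2r // is_norm_ge0.
have H2 : N (C *m z) <= omega1 * (vtheta * (N h + N y)).
  apply: le_trans (le_opnorm hN _ _) _.
  by apply: ler_pM; rewrite ?opnorm_ge0 ?is_norm_ge0.
have H3 : N ((C - 1%:M) *m h) <= omega2 * N h.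
  apply: le_trans (le_opnorm hN _ _) _.
  by rewrite ler_wpM2r // is_norm_ge0.
have H4 : omega1 * (1 + vtheta) * N y <=
    omega1 * (1 + vtheta) * (u / (2 * (1 - u) ^+ 2 - 1) * N h).
  by rewrite ler_wpM2l // mulr_ge0 // addr_ge0.
rewrite SE; apply: le_trans (is_normB hN _ _) _.
apply: le_trans (lerD (is_normD hN _ _) H3) _.
move: H1 H2 H4; set q := u / _; lra.
Qed.

End NewtonLikeStep.

(** * Convergence of the iteration *)

Theorem theorem15 (R : realType) (n : nat) (N : 'cV[R]_n -> R) (hN : is_norm N)
    (Omega : set 'cV[R]_n) (Omega_open : open Omega)
    (F : 'cV[R]_n -> 'cV[R]_n)
    (F_analytic : forall x, Omega x -> analytic_at F x)
    (xs : 'cV[R]_n) (xs_Omega : Omega xs)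
    (F'xs_inv : jac F xs \in unitmx) (Fxs : F xs = 0)
    (kappa : \bar R) (kappaE : kappa = inscribed_radius N Omega xs)
    (gamma : R) (gammaE : gamma%:E = smale_gamma N F xs) (gamma_gt0 : 0 < gamma)
    (vtheta omega1 omega2 : R)
    (vtheta_ge0 : 0 <= vtheta) (vtheta_lt1 : vtheta < 1)
    (omega2_ge0 : 0 <= omega2) (omega2_lt : omega2 < omega1)
    (omega_lt1 : omega1 * vtheta + omega2 < 1)
    (a b : R) (aE : a = omega1 * (1 + vtheta))
    (bE : b = 1 - omega1 * vtheta - omega2)
    (sigma : \bar R)
    (sigmaE : sigma = Order.min kappa
       ((a + 4 * b - Num.sqrt ((a + 4 * b) ^+ 2 - 8 * b ^+ 2))
          / (4 * b * gamma))%:E)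
    (B : 'cV[R]_n -> 'M[R]_n) (P : nat -> 'M[R]_n) (theta : nat -> R)
    (r S x : nat -> 'cV[R]_n)
    (x0_ball : nball N xs sigma (x 0%N)) (x0_neq : x 0%N != xs) :
  (* well defined: after any finite run, the next step makes sense *)
  (forall K : nat,
     (forall k, (k < K)%N ->
        inexact_newton_like_step N F omega1 omega2 vtheta B P theta r S x k) ->
     Omega (x K) /\ jac F (x K) \in unitmx) /\
  ((forall k,
      inexact_newton_like_step N F omega1 omega2 vtheta B P theta r S x k) ->
   [/\ forall k, nball N xs sigma (x k),
       x @ \oo --> xs
     & forall k,
         N (x k.+1 - xs) <=
           (omega1 * (1 + vtheta)
              * (gamma * N (x 0%N - xs)
                   / (2 * (1 - gamma * N (x 0%N - xs)) ^+ 2 - 1))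
            + omega1 * vtheta + omega2) * N (x k - xs)]).
Proof.
set t0 := N (x 0%N - xs).
have t00 : 0 <= t0 := is_norm_ge0 hN _.
have o1 : 0 <= omega1 by exact: le_trans (ltW omega2_lt).
have b0 : 0 < b by rewrite bE; lra.
have a0 : 0 <= a by rewrite aE mulr_ge0 // addr_ge0.
have t0sigma : (t0%:E < sigma)%E by [].
(* Since [t0] lies strictly below the supremum [kappa], some admissible radius exceeds [t0]. *)
have [t' t't0 t'Omega] : exists2 t', t0 < t' & nball N xs t'%:E `<=` Omega.
  have : (t0%:E < kappa)%E by apply: lt_le_trans t0sigma _; rewrite sigmaE ge_min lexx.
  by rewrite kappaE => /ereal_sup_gt[_ [t' [_ t'O] <-]]; rewrite lte_fin; exists t'.
have gt00 : 0 <= gamma * t0 by rewrite mulr_ge0 // ltW.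
have [u1 uden contr] : [/\ gamma * t0 < 1, 0 < 2 * (1 - gamma * t0) ^+ 2 - 1 &
    a * (gamma * t0 / (2 * (1 - gamma * t0) ^+ 2 - 1)) < b].
  apply: small_root_bounds => //; rewrite -ltr_pdivlMl // -mulrCA -invfM.
  rewrite -lte_fin [gamma * _]mulrC; apply: lt_le_trans t0sigma _.
  by rewrite sigmaE ge_min lexx orbT.
have seg y : N (y - xs) <= t0 -> forall s, 0 <= s <= 1 -> Omega (xs + s *: (y - xs)).
  move=> yt s /andP[s0 s1]; apply: t'Omega; rewrite /nball /= lte_fin.
  rewrite addrC addKr is_normZ // ger0_norm //; apply: le_lt_trans t't0.
  apply: le_trans yt; rewrite -[leRHS]mul1r ler_wpM2r // is_norm_ge0 //.
(* Every point at distance at most [t0] inherits the bounds of the initial point, so one contraction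
   factor serves all steps. *)
have small y : N (y - xs) <= t0 -> [/\ gamma * N (y - xs) < 1,
    0 < 2 * (1 - gamma * N (y - xs)) ^+ 2 - 1 &
    gamma * N (y - xs) / (2 * (1 - gamma * N (y - xs)) ^+ 2 - 1) <=
      gamma * t0 / (2 * (1 - gamma * t0) ^+ 2 - 1)].
  move=> yt; have ut : gamma * N (y - xs) <= gamma * t0 by rewrite ler_wpM2l // ltW.
  have u0 : 0 <= gamma * N (y - xs) by rewrite mulr_ge0 ?is_norm_ge0 // ltW.
  split; [exact: le_lt_trans u1|by nra|exact: newton_factor_le].
have g0 := ltW gamma_gt0.
set rho := omega1 * (1 + vtheta) * (gamma * t0 / (2 * (1 - gamma * t0) ^+ 2 - 1))
            + omega1 * vtheta + omega2.
have q0 : 0 <= gamma * t0 / (2 * (1 - gamma * t0) ^+ 2 - 1) by rewrite divr_ge0 // ltW.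
have rho0 : 0 <= rho by rewrite /rho -aE addr_ge0 // addr_ge0 // mulr_ge0.
have rho1 : rho < 1 by move: contr; rewrite aE bE /rho; lra.
have xsK y : xs + (y - xs) = y by rewrite addrC subrK.
have step k : N (x k - xs) <= t0 ->
    inexact_newton_like_step N F omega1 omega2 vtheta B P theta r S x k ->
    N (x k.+1 - xs) <= rho * N (x k - xs).
  move=> xk [[-> BS] [Bu B1 B2] [Pu th0] Pr thc]; have [v1 vden vle] := small _ xk.
  have -> : x k + S k - xs = (x k - xs) + S k by rewrite addrAC.
  apply: le_trans (newton_like_step hN _ _ _ Omega_open xs_Omega F_analytic F'xs_inv
    Fxs _ gammaE g0 _ _ (xsK _) (seg _ xk) v1 vden _ _ _ _ _ _ _ _ o1 vtheta_ge0 th0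
    BS Bu Pu B1 B2 Pr thc) _.
  by rewrite ler_wpM2r ?is_norm_ge0 // !lerD2r ler_wpM2l // -aE.
(* Only the steps before K are assumed, so that the bound also applies to finite runs, as
   well-definedness requires. *)
have bound K : (forall k, (k < K)%N ->
      inexact_newton_like_step N F omega1 omega2 vtheta B P theta r S x k) ->
    N (x K - xs) <= rho ^+ K * t0.
  elim: K => [_|K IH steps]; first by rewrite expr0 mul1r.
  have {}IH := IH (fun k kK => steps k (ltnW kK)).
  have xK : N (x K - xs) <= t0.
    by apply: le_trans IH _; rewrite ler_piMl // exprn_ile1 // ltW.
  apply: le_trans (step K xK (steps K (ltnSn K))) _.
  by rewrite exprS -mulrA ler_wpM2l.
have bound_t0 K : (forall k, (k < K)%N ->
      inexact_newton_like_step N F omega1 omega2 vtheta B P theta r S x k) ->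
    N (x K - xs) <= t0.
  by move=> /bound H; apply: le_trans H _; rewrite ler_piMl // exprn_ile1 // ltW.
split.
  move=> K /bound_t0 xK; have [v1 vden _] := small _ xK; split.
    by have := seg _ xK 1; rewrite ler01 lexx scale1r xsK; apply.
  exact: (jac_unit hN _ _ _ Omega_open xs_Omega F_analytic F'xs_inv
    _ gammaE g0 _ _ (xsK _) (seg _ xK) v1 vden).
move=> steps; have xk k : N (x k - xs) <= t0 by apply: bound_t0 => j _.
split.
- by move=> k; apply: le_lt_trans t0sigma; rewrite lee_fin.
- have [c c0 Nc] := mx_le_is_norm hN.
  apply/cvgrPdist_le => e e0.
  (* The geometric decay in N is transferred to the library norm by the constant c. *)
  have : (fun k => (c * t0) * rho ^+ k) @ \oo --> (0 : R).
    by apply: cvg_geometric; rewrite ger0_norm.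
  move=> /cvgrPdist_le /(_ e e0); apply: filterS => k /=.
  rewrite sub0r normrN ger0_norm ?mulr_ge0 ?exprn_ge0 ?(ltW c0) //; apply: le_trans.
  rewrite distrC; apply: le_trans (Nc _) _; rewrite -mulrA ler_wpM2l ?(ltW c0) //.
  by rewrite mulrC; apply: bound => j _.
- by move=> k; exact: step.
Qed.
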